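(* Fix an integer $d\geq 2$. For each positive integer $k$, let $\delta_z(d,k)$ denote the largest possible diameter of a lattice zonotope contained in the hypercube $[0,k]^d$. Then $$\delta_z(d,k)\sim c(d)\,k^{\frac{d}{d+1}}\quad\text{as } k\to\infty,\qquad\text{where } c(d)=\left(\frac{2^d(d+1)^d}{2\,d!\,\zeta(d)}\right)^{\frac{1}{d+1}},$$ i.e. $\lim_{k\to\infty}\delta_z(d,k)/k^{d/(d+1)}=c(d)$.
   Context: A lattice polytope in $\mathbb{R}^d$ is a polytope all of whose vertices lie in $\mathbb{Z}^d$. A zonotope is a Minkowski sum of finitely many pairwise non-collinear line segments (its generators); a lattice zonotope is a zonotope that is a lattice polytope. The diameter of a polytope is the diameter of its graph (the graph formed by its vertices and edges). $\zeta$ denotes the Riemann zeta function. *)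

(* Defs.v *)
From HB Require Import structures.
From mathcomp Require Import all_boot all_order all_algebra.
From mathcomp Require Import all_classical all_reals all_analysis.

Set Implicit Arguments.
Unset Strict Implicit.
Unset Printing Implicit Defensive.

Import Order.TTheory GRing.Theory Num.Theory.
Import numFieldNormedType.Exports.

Local Open Scope classical_set_scope.
Local Open Scope ring_scope.

Section Polytopes.
Context {R : realType} {d : nat}.
Implicit Types (u v x y c : 'rV[R]_d) (A P Z F : set 'rV[R]_d).

Definition dotp x y : R := \sum_(i < d) x ord0 i * y ord0 i.

Definition segment u v : set 'rV[R]_d :=
  [set (1 - t) *: u + t *: v | t in [set t : R | 0 <= t <= 1]].

Definition convex_hull A : set 'rV[R]_d := smallest (fun B => convex_set B) A.

Definition is_polytope P : Prop :=
  exists2 A, finite_set A & P = convex_hull A.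

(* The nonempty faces of P; c = 0 gives P itself. *)
Definition is_face P F : Prop :=
  exists c, F = [set x | P x /\ forall y, P y -> dotp c y <= dotp c x].

Definition is_vertex P v : Prop := is_face P [set v].

(* The one-dimensional faces of a polytope are its faces that are
   nondegenerate segments; the end points are then vertices. *)
Definition spans_edge P u v : Prop := u <> v /\ is_face P (segment u v).

Definition is_walk P u (s : seq 'rV[R]_d) v : Prop :=
  path [rel x y | `[< spans_edge P x y >]] u s /\ last u s = v.

Definition is_graph_distance P u v (n : nat) : Prop :=
  (exists2 s, is_walk P u s v & size s = n) /\
  (forall s, is_walk P u s v -> (n <= size s)%N).

(* The first clause also requires the graph to be connected. *)
Definition has_diameter P (n : nat) : Prop :=
  (forall u v, is_vertex P u -> is_vertex P v ->
     exists2 m : nat, is_graph_distance P u v m & (m <= n)%N) /\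
  (exists u v, [/\ is_vertex P u, is_vertex P v & is_graph_distance P u v n]).

Definition is_lattice_polytope P : Prop :=
  is_polytope P /\
  forall v, is_vertex P v -> forall i, v ord0 i \is a Num.int.

Definition minkowski_sum (n : nat) (S : 'I_n -> set 'rV[R]_d) : set 'rV[R]_d :=
  [set x | exists2 p : 'I_n -> 'rV[R]_d,
             forall i, S i (p i) & x = \sum_(i < n) p i].

(* Non-collinearity of two segments means that their directions are linearly
   independent. *)
Definition is_zonotope Z : Prop :=
  exists (n : nat) (a b : 'I_n -> 'rV[R]_d),
    [/\ forall i, a i <> b i,
        forall i j, i <> j -> free [:: b i - a i; b j - a j] &
        Z = minkowski_sum (fun i => segment (a i) (b i))].

Definition is_lattice_zonotope Z : Prop :=
  is_zonotope Z /\ is_lattice_polytope Z.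

Definition hypercube (k : nat) : set 'rV[R]_d :=
  [set x | forall i, 0 <= x ord0 i <= k%:R].

End Polytopes.

Section Constants.
Variable R : realType.

Definition zonotope_diameters (d k : nat) : set nat :=
  [set n | exists Z : set 'rV[R]_d,
     [/\ is_lattice_zonotope Z, Z `<=` hypercube k & has_diameter Z n]].

(* The largest element of the set of diameters; the default 0 would be taken
   only if there were no largest element. *)
Definition delta_z (d k : nat) : nat :=
  xget 0%N (zonotope_diameters d k `&` ubound (zonotope_diameters d k)).

(* The Dirichlet series of the Riemann zeta function, at integers s >= 2. *)
Definition zeta (s : nat) : R :=
  limn (series (fun n : nat => (n.+1%:R ^+ s)^-1 : R)).

Definition c_zonotope (d : nat) : R :=
  ((2 ^+ d * d.+1%:R ^+ d) / (2 * d`!%:R * zeta d)) `^ (d.+1%:R^-1).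

End Constants.

(* Main.v *)
Require Import Defs.
From HB Require Import structures.
From mathcomp Require Import all_boot all_order all_algebra.
From mathcomp Require Import all_classical all_reals all_analysis.
From mathcomp Require Import perm ring lra zify.

Set Implicit Arguments.
Unset Strict Implicit.
Unset Printing Implicit Defensive.

Import Order.TTheory GRing.Theory Num.Theory.
Import numFieldNormedType.Exports.

Local Open Scope classical_set_scope.
Local Open Scope ring_scope.

(** For a zonotope with generators [g_1, ..., g_n], the vertices are read off
    the sign vectors of the functionals that vanish on no generator, an edge
    flips one sign, and a generic segment of functionals flips the differing
    signs one at a time; hence the diameter is [n].  If the zonotope is a lattice
    polytope then each [g_i], being a difference of two vertices, is integral,
    and lying in [[0, k]^d] bounds [\sum_i |g_i|_1] by [d k].

    So one maximizes the number of pairwise nonparallel integer vectors under a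
    bound on the sum of their norms, and the best choice is essentially all
    primitive vectors, one of each pair [v], [- v], of norm at most
    [r]; by symmetry their zonotope has the same width in all coordinates.
    There are [N r ~ A r^d] of them with [A = 2^d / (2 d! zeta d)], with sum of
    norms [~ A d / (d+1) r^(d+1)], and equating the latter with [d k] gives
    [N r ~ c k^(d/(d+1))].

    The count of primitive vectors follows from that of all lattice points
    through [L x = 1 + \sum_m P (x / m)]: as [\sum_(m >= 2) m^-d < 1], this
    determines the leading term of [P] by contraction, without Moebius
    inversion. *)

(** * Linear functionals *)

Section DotProduct.
Context {R : realType} {d : nat}.
Implicit Types (x y z c w h : 'rV[R]_d).

Lemma dotpC x y : dotp x y = dotp y x.
Proof. by apply: eq_bigr => i _; rewrite mulrC. Qed.

Lemma dotpDr x y z : dotp x (y + z) = dotp x y + dotp x z.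
Proof. by rewrite -big_split; apply: eq_bigr => i _; rewrite mxE mulrDr. Qed.

Lemma dotpZr x k y : dotp x (k *: y) = k * dotp x y.
Proof. by rewrite mulr_sumr; apply: eq_bigr => i _; rewrite mxE mulrCA. Qed.

Lemma dotp0r x : dotp x 0 = 0.
Proof. by rewrite -(scale0r 0) dotpZr mul0r. Qed.

Lemma dotpNr x y : dotp x (- y) = - dotp x y.
Proof. by rewrite -scaleN1r dotpZr mulN1r. Qed.

Lemma dotpBr x y z : dotp x (y - z) = dotp x y - dotp x z.
Proof. by rewrite dotpDr dotpNr. Qed.

Lemma dotpDl x y z : dotp (x + y) z = dotp x z + dotp y z.
Proof. by rewrite dotpC dotpDr !(dotpC z). Qed.

Lemma dotpZl k x y : dotp (k *: x) y = k * dotp x y.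
Proof. by rewrite dotpC dotpZr (dotpC y). Qed.

Lemma dotpNl x y : dotp (- x) y = - dotp x y.
Proof. by rewrite dotpC dotpNr (dotpC y). Qed.

Lemma dotpBl x y z : dotp (x - y) z = dotp x z - dotp y z.
Proof. by rewrite dotpDl dotpNl. Qed.

Lemma dotp_sumr x (I : finType) (F : I -> 'rV[R]_d) :
  dotp x (\sum_i F i) = \sum_i dotp x (F i).
Proof.
exact: (big_morph (dotp x) (dotpDr x) (dotp0r x)).
Qed.

Lemma dotp_gt0 x : x != 0 -> 0 < dotp x x.
Proof.
move=> x0; have xx i : 0 <= x ord0 i * x ord0 i by rewrite -expr2 sqr_ge0.
rewrite lt_def sumr_ge0// andbT; apply: contra x0 => /eqP/psumr_eq0P x0.
apply/eqP/rowP => i; rewrite mxE; apply/eqP.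
by rewrite -sqrf_eq0 expr2 x0.
Qed.

Lemma dotp_eq0 x : (dotp x x == 0) = (x == 0).
Proof.
apply/idP/idP => [|/eqP ->]; last by rewrite dotp0r.
by apply: contraTT => /dotp_gt0 /lt0r_neq0.
Qed.

(** The [+ 1] in the denominators keeps each bound meaningful when [be i = 0]; the minimum of these
    finitely many bounds serves the whole list. *)
Lemma small_perturbation (I : eqType) (s : seq I) (al be : I -> R) :
  exists2 e, 0 < e & forall i, i \in s -> al i != 0 -> e * `|be i| < `|al i|.
Proof.
elim: s => [|i s [e e0 IH]]; first by exists 1.
have [ai0|ai0] := eqVneq (al i) 0.
  exists e => // j; rewrite inE => /orP[/eqP ->|]; first by rewrite ai0 eqxx.
  exact: IH.
have b0 : 0 < `|be i| + 1 by rewrite ltr_wpDl.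
exists (Num.min e (`|al i| / (`|be i| + 1))).
  by rewrite lt_min e0 divr_gt0 ?normr_gt0.
move=> j; rewrite inE => /orP[/eqP -> _|js aj0]; last first.
  by apply: le_lt_trans (IH j js aj0); rewrite ler_wpM2r// ge_min lexx.
apply: (@le_lt_trans _ _ (`|al i| / (`|be i| + 1) * `|be i|)).
  by rewrite ler_wpM2r// ge_min lexx orbT.
by rewrite mulrAC ltr_pdivrMr// ltr_pM2l ?normr_gt0// ltrDl.
Qed.

(** For small [e], passing to [c + e *: w] keeps the nonzero signs of [c] and lets [w] break the
    ties. *)
Lemma perturb_functional (s : seq 'rV[R]_d) c w : exists c', forall h, h \in s ->
  Num.sg (dotp c' h) =
    if dotp c h == 0 then Num.sg (dotp w h) else Num.sg (dotp c h).
Proof.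
have [e e0 He] := small_perturbation s (dotp c) (dotp w).
exists (c + e *: w) => h hs; rewrite dotpDl dotpZl.
case: eqP => [->|/eqP ch0]; first by rewrite add0r sgrM gtr0_sg// mul1r.
have := He h hs ch0; set x := dotp c h in ch0 *; set y := dotp w h.
have -> : e * `|y| = `|e * y| by rewrite normrM gtr0_norm.
have [x0|x0|/eqP] := ltrgt0P x; last by rewrite (negPf ch0).
- rewrite ltr_norml => /andP[? ?]; rewrite !gtr0_sg//; lra.
- rewrite ltr_norml => /andP[? ?]; rewrite !ltr0_sg//; lra.
Qed.

Lemma generic_functional (s : seq 'rV[R]_d) :
  (forall h, h \in s -> h != 0) ->
  exists c, forall h, h \in s -> dotp c h != 0.
Proof.
elim: s => [|h s IH] s0; first by exists 0.
have [|c Hc] := IH; first by move=> x xs; apply: s0; rewrite inE xs orbT.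
(* Perturbing in the direction of [h] itself settles [h], since [dotp h h > 0], and spoils no value
   already nonzero. *)
have [c' Hc'] := perturb_functional (h :: s) c h.
exists c' => x xs; rewrite -sgr_eq0 Hc'//; case: ifPn => [/eqP cx|]; last first.
  by rewrite sgr_eq0.
rewrite sgr_eq0; move: xs cx; rewrite inE => /orP[/eqP -> _|xs cx].
  by rewrite dotp_eq0 s0// mem_head.
by have := Hc x xs; rewrite cx eqxx.
Qed.

End DotProduct.

Lemma sgr_eq_gt0 (R : realDomainType) (x y : R) :
  Num.sg x = Num.sg y -> (0 < x) = (0 < y).
Proof. by move=> xy; rewrite -(sgr_gt0 x) xy sgr_gt0. Qed.

Lemma sgr_eq_eq0 (R : realDomainType) (x y : R) :
  Num.sg x = Num.sg y -> (x == 0) = (y == 0).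
Proof. by move=> xy; rewrite -(sgr_eq0 x) xy sgr_eq0. Qed.

Lemma free2P (R : fieldType) (vT : vectType R) (u v : vT) :
  reflect (forall x y, x *: u + y *: v = 0 -> x = 0 /\ y = 0) (free [:: u; v]).
Proof.
apply: (iffP idP) => [|H].
  rewrite free_cons seq1_free span_seq1 => /andP[uv v0] x y xy.
  have x0 : x = 0.
    apply/eqP; apply: contraNT uv => x0; apply/vlineP.
    exists (- (x^-1 * y)); rewrite scaleNr -scalerA -[y *: v](addKr (x *: u)) xy.
    by rewrite addr0 scalerN opprK scalerA mulVf// scale1r.
  split=> //; move/eqP: xy; rewrite x0 scale0r add0r scaler_eq0 (negPf v0) orbF.
  by move/eqP.
rewrite free_cons seq1_free span_seq1; apply/andP; split.
  apply/negP => /vlineP[k uk].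
  have [] := H 1 (- k); first by rewrite scale1r scaleNr uk subrr.
  by move/eqP; rewrite oner_eq0.
apply/eqP => v0; have [] := H 0 1; first by rewrite scale0r v0 scaler0 addr0.
by move=> _ /eqP; rewrite oner_eq0.
Qed.

(** * Faces and graph of a zonotope *)

Definition hamming (n : nat) (e f : 'I_n -> bool) : nat :=
  #|[pred i | e i != f i]|.

Definition flip (n : nat) (i : 'I_n) (e : 'I_n -> bool) : 'I_n -> bool :=
  fun j => (j == i) (+) e j.

Lemma hamming_trans (n : nat) (e f g : 'I_n -> bool) :
  (hamming e g <= hamming e f + hamming f g)%N.
Proof.
rewrite -cardUI (leq_trans _ (leq_addr _ _))//; apply: subset_leq_card.
by apply/fintype.subsetP => i; rewrite !inE; case: (e i) (f i) (g i) => [] [] [].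
Qed.

Lemma hamming_flip (n : nat) (i : 'I_n) (e f : 'I_n -> bool) :
  e i != f i -> hamming e f = (hamming (flip i e) f).+1.
Proof.
move=> ei; rewrite /hamming (cardD1 i) inE ei add1n; congr S.
apply: eq_card => j; rewrite !inE /flip; case: eqP => [->|]//=.
by rewrite -addNb; case: (e i) (f i) ei => [] [].
Qed.

Lemma hamming_negb (n : nat) (e : 'I_n -> bool) :
  hamming e (fun i => ~~ e i) = n.
Proof.
rewrite -[RHS]card_ord; apply: eq_card => i; rewrite !inE.
by case: (e i).
Qed.

Section Zonotope.
Context {R : realType} {d n : nat}.
Variables a g : 'I_n -> 'rV[R]_d.
Implicit Types (c x : 'rV[R]_d) (t : 'I_n -> R) (e : 'I_n -> bool).

Definition zpoint t : 'rV[R]_d := \sum_i (a i + t i *: g i).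

Definition unit_cube : set ('I_n -> R) := [set t | forall i, 0 <= t i <= 1].

Definition zonotope : set 'rV[R]_d := [set zpoint t | t in unit_cube].

Definition zface c : set 'rV[R]_d :=
  [set x | zonotope x /\ forall y, zonotope y -> dotp c y <= dotp c x].

Definition boolpt e : 'rV[R]_d := zpoint (fun i => (e i)%:R).

Definition sgnvec c : 'I_n -> bool := fun i => 0 < dotp c (g i).

(** A generator on which [c] vanishes leaves its parameter free; such generators give the directions
    of the face. *)
Definition maximizes c t : Prop := forall i,
  (0 < dotp c (g i) -> t i = 1) /\ (dotp c (g i) < 0 -> t i = 0).

Lemma dotp_zpoint c t :
  dotp c (zpoint t) = \sum_i (dotp c (a i) + t i * dotp c (g i)).
Proof. by rewrite dotp_sumr; apply: eq_bigr => i _; rewrite dotpDr dotpZr. Qed.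

Lemma zpointB t t' : zpoint t - zpoint t' = \sum_i (t i - t' i) *: g i.
Proof.
rewrite /zpoint -sumrB; apply: eq_bigr => i _.
by rewrite scalerBl opprD addrACA subrr add0r.
Qed.

Lemma zpoint_conv (s : R) t t' :
  (1 - s) *: zpoint t + s *: zpoint t' =
  zpoint (fun i => (1 - s) * t i + s * t' i).
Proof.
rewrite /zpoint !scaler_sumr -big_split/=; apply: eq_bigr => i _.
by apply/rowP => k; rewrite !mxE; ring.
Qed.

Lemma zpointB1 i t t' : (forall j, j != i -> t j = t' j) ->
  zpoint t - zpoint t' = (t i - t' i) *: g i.
Proof.
move=> tt'; rewrite zpointB (bigD1 i)//= big1 ?addr0// => j ji.
by rewrite tt'// subrr scale0r.
Qed.

Lemma unit_cube_bool e : unit_cube (fun i => (e i)%:R).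
Proof. by move=> i; case: (e i); rewrite !lexx ?ler01. Qed.

Lemma unit_cube_upd i (z : R) t : unit_cube t -> 0 <= z <= 1 ->
  unit_cube (fun j => if j == i then z else t j).
Proof. by move=> ct z01 j; case: eqP. Qed.

(** The functional is a sum of terms in separate parameters, so it is maximal exactly when each term
    is; necessity is tested by changing one parameter at a time. *)
Lemma zfaceP c t : unit_cube t -> zface c (zpoint t) <-> maximizes c t.
Proof.
move=> ct; split=> [[_ H] i|H].
  have K (z : R) : 0 <= z <= 1 -> (z - t i) * dotp c (g i) <= 0.
    move=> z01; have := H _ (imageP zpoint (unit_cube_upd i ct z01)).
    rewrite -subr_le0 -dotpBr (@zpointB1 i) ?eqxx ?dotpZr// => j /negPf ->//.
  have /andP[t0 t1] := ct i.
  split=> [c0|c0].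
    have := K 1; rewrite ler01 lexx => /(_ isT); rewrite pmulr_lle0// => ?.
    by apply/eqP; rewrite eq_le t1 -subr_le0.
  have := K 0; rewrite ler01 lexx => /(_ isT); rewrite nmulr_lle0// => ?.
  by apply/eqP; rewrite eq_le t0 andbT -oppr_ge0 -sub0r.
split; first by exists t.
move=> _ [t' ct' <-]; rewrite !dotp_zpoint ler_sum// => i _; rewrite lerD2l.
have [Hp Hn] := H i; have /andP[t0 t1] := ct' i.
have [c0|c0|->] := ltrgt0P (dotp c (g i)); last by rewrite !mulr0.
- by rewrite Hp// mul1r ler_piMl// ltW.
- by rewrite Hn// mul0r mulr_ge0_le0// ltW.
Qed.

Lemma maximizes_generic c t : (forall i, dotp c (g i) != 0) ->
  maximizes c t <-> t = fun i => (sgnvec c i)%:R.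
Proof.
move=> c0; split=> [H|-> i].
  apply/funext => i; rewrite /sgnvec; have [Hp Hn] := H i.
  have [/Hp//|/Hn//|/eqP] := ltrgt0P (dotp c (g i)).
  by rewrite (negPf (c0 i)).
rewrite /sgnvec; split=> [->//|ci].
by rewrite ltNge ltW.
Qed.

Lemma zface_generic c : (forall i, dotp c (g i) != 0) ->
  zface c = [set boolpt (sgnvec c)].
Proof.
move=> c0; apply/seteqP; split=> [x|x ->].
  move=> cx; have [[t ct tx] _] := cx; move: cx; rewrite -tx zfaceP//.
  by move=> /(maximizes_generic _ c0) ->.
by rewrite /boolpt zfaceP; [exact/maximizes_generic|exact: unit_cube_bool].
Qed.

Lemma vertex_generic c : (forall i, dotp c (g i) != 0) ->
  is_vertex zonotope (boolpt (sgnvec c)).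
Proof. by move=> c0; exists c; rewrite -zface_generic. Qed.

Lemma boolpt_generic_inj c e : (forall i, dotp c (g i) != 0) ->
  boolpt e = boolpt (sgnvec c) -> e = sgnvec c.
Proof.
move=> c0 eE; have : zface c (boolpt e) by rewrite zface_generic.
rewrite zfaceP; last exact: unit_cube_bool.
move=> /(maximizes_generic _ c0) E; apply/funext => i.
move: (congr1 (fun f => f i) E) => /eqP; rewrite eqr_nat.
by case: (e i) (sgnvec c i) => [] [].
Qed.

Hypothesis g_neq0 : forall i, g i != 0.

(** If the functional vanished on [g i], the [i]-th parameter could vary inside the face, which
    would then contain two points differing by [g i]. *)
Lemma vertexP v : is_vertex zonotope v ->
  exists2 c, forall i, dotp c (g i) != 0 & v = boolpt (sgnvec c).
Proof.
case=> c; rewrite -/(zface c) => vE.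
have vc : zface c v by rewrite -vE.
have [[t ct tv] _] := vc.
suff c0 i : dotp c (g i) != 0.
  by exists c => //; move: vc; rewrite zface_generic.
apply/eqP => ci0.
have K (z : R) : 0 <= z <= 1 -> zpoint (fun j => if j == i then z else t j) = v.
  move=> z01; suff : [set v] (zpoint (fun j => if j == i then z else t j)) by [].
  rewrite vE zfaceP; last exact: unit_cube_upd.
  move: vc; rewrite -tv zfaceP// => H j; case: eqP => [->|_]; last exact: H.
  by rewrite ci0 ltxx.
have : zpoint (fun j => if j == i then 1 else t j) =
       zpoint (fun j => if j == i then 0 else t j) by rewrite !K ?ler01 ?lexx.
move/eqP; rewrite -subr_eq0 (@zpointB1 i) ?eqxx ?subr0 ?scale1r => [|j /negPf ->//].
by rewrite (negPf (g_neq0 i)).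
Qed.

Lemma segment_sym (u v : 'rV[R]_d) : segment u v = segment v u.
Proof.
rewrite /segment; apply/seteqP; split=> x [t /= /andP[t0 t1] <-];
  (exists (1 - t); [by apply/andP; split; lra | by rewrite opprB addrCA subrr addr0 addrC]).
Qed.

(** On the face of [c] every parameter but the [i]-th is pinned, so the face is a translate of the
    segment from 0 to [g i]. *)
Lemma edge_flip c e i : dotp c (g i) = 0 ->
  (forall j, j != i -> dotp c (g j) != 0 /\ e j = sgnvec c j) ->
  spans_edge zonotope (boolpt e) (boolpt (flip i e)).
Proof.
move=> ci0 cj.
wlog ei : e cj / e i = false => [W|].
  case ei : (e i); last exact: W.
  have [] := W (flip i e); first by move=> j ji; have [? <-] := cj j ji; rewrite /flip (negPf ji).
    by rewrite /flip eqxx ei.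
  have -> : flip i (flip i e) = e by apply/funext => j; rewrite /flip addbA addbb.
  by move=> ne fc; split; [exact: nesym|rewrite segment_sym].
split.
  move/eqP; rewrite eq_sym -subr_eq0 (@zpointB1 i) => [|j /negPf ji].
    by rewrite /flip eqxx ei subr0 scale1r (negPf (g_neq0 i)).
  by rewrite /flip ji.
exists c; rewrite -/(zface c); apply/seteqP; split=> x.
  case=> s /= s01 <-; rewrite zpoint_conv zfaceP.
    move=> j; have [->|ji] := eqVneq j i; first by rewrite ci0 ltxx.
    have [c0 ej] := cj j ji; rewrite /flip (negPf ji)/= -mulrDl subrK mul1r ej /sgnvec.
    by split=> [->//|cj0]; rewrite ltNge ltW.
  move=> j; rewrite /flip; case: eqP => [->|_]/=.
    by rewrite ei/= mulr0 add0r mulr1.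
  by rewrite -mulrDl subrK mul1r; case: (e j); rewrite ?lexx ?ler01.
move=> xf; have [[t ct tx] _] := xf; exists (t i); first exact: ct.
rewrite zpoint_conv -tx; congr zpoint; apply/funext => j; rewrite /flip.
case: eqP => [->|/eqP ji]/=; first by rewrite ei/= mulr0 add0r mulr1.
move: xf; rewrite -tx zfaceP// => /(_ j)[Hp Hn]; have [c0 ->] := cj j ji.
rewrite -mulrDl subrK mul1r /sgnvec.
have [/Hp//|/Hn//|/eqP] := ltrgt0P (dotp c (g j)).
by rewrite (negPf c0).
Qed.

Hypothesis g_free : forall i j, i != j -> free [:: g i; g j].

(** Generators orthogonal to the functional of the edge are parallel to [v - u], so there is at most
    one, and the ends differ in its parameter only. The first clause makes the parameter of [u]
    unique, so that consecutive edges of a walk agree on the sign vector of their common vertex. *)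
Lemma edgeP u v : spans_edge zonotope u v -> exists e f,
  [/\ forall t, unit_cube t -> zpoint t = u -> t = fun i => (e i)%:R,
      v = boolpt f & (hamming e f <= 1)%N].
Proof.
case=> uv [c]; rewrite -/(zface c) => fE.
have fu : zface c u.
  by rewrite -fE; exists 0; rewrite /= ?lexx ?ler01// subr0 scale1r scale0r addr0.
have fv : zface c v.
  by rewrite -fE; exists 1; rewrite /= ?lexx ?ler01// subrr scale1r scale0r add0r.
have [[tu cu tuu] _] := fu; have [[tv cv tvv] _] := fv.
have mu : maximizes c tu by apply/zfaceP; rewrite ?tuu.
have mv : maximizes c tv by apply/zfaceP; rewrite ?tvv.
pose up i (z : R) := zpoint (fun j => if j == i then z else tu j).
have upf i (z : R) : dotp c (g i) = 0 -> 0 <= z <= 1 -> zface c (up i z).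
  move=> ci z01; rewrite zfaceP; last exact: unit_cube_upd.
  by move=> j; case: eqP => [->|_]; [rewrite ci ltxx|exact: mu].
have upB i z z' : up i z - up i z' = (z - z') *: g i.
  by rewrite /up (@zpointB1 i) ?eqxx// => j /negPf ->.
(* The values 1 and 0 of the [i]-th parameter give two points of the segment whose difference is
   [g i]. *)
have gpar i : dotp c (g i) = 0 -> exists2 s : R, s != 0 & g i = s *: (v - u).
  move=> ci.
  have := @upf i 1 ci; rewrite ler01 lexx -fE => /(_ isT)[s1 _ e1].
  have := @upf i 0 ci; rewrite ler01 lexx -fE => /(_ isT)[s0 _ e0].
  have gE : g i = (s1 - s0) *: (v - u).
    rewrite -[g i]scale1r -[1]subr0 -upB -e1 -e0.
    rewrite !scalerBl !scalerBr !scale1r !opprB !opprD !opprK.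
    by apply/rowP => k; rewrite !mxE; ring.
  exists (s1 - s0) => //; apply/eqP => s0E.
  by have := g_neq0 i; rewrite gE s0E scale0r eqxx.
have uniqz i j : dotp c (g i) = 0 -> dotp c (g j) = 0 -> i = j.
  move=> ci cj; apply/eqP; apply/negPn/negP => ij.
  have [si si0 gi] := gpar i ci; have [sj sj0 gj] := gpar j cj.
  have /free2P/(_ sj (- si)) := g_free ij.
  rewrite gi gj !scalerA -scalerDl mulNr [sj * _]mulrC subrr scale0r.
  by move=> /(_ erefl)[/eqP]; rewrite (negPf sj0).
have [[i ci]|nz] := pselect (exists i, dotp c (g i) = 0); last first.
  case: uv; have c0 i : dotp c (g i) != 0 by apply/eqP => ci; apply: nz; exists i.
  by move: fu fv; rewrite (zface_generic c0) => -> ->.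
have cj j : j != i -> dotp c (g j) != 0.
  by move=> ji; apply: contraNN ji => /eqP cj; apply/eqP; exact: uniqz.
have fixed t j : maximizes c t -> j != i -> t j = (sgnvec c j)%:R.
  move=> /(_ j)[Hp Hn] ji; rewrite /sgnvec.
  have [/Hp//|/Hn//|/eqP] := ltrgt0P (dotp c (g j)).
  by rewrite (negPf (cj j ji)).
have upE z s : up i z = (1 - s) *: u + s *: v -> z = (1 - s) * tu i + s * tv i.
  rewrite -tuu -tvv zpoint_conv => /eqP; rewrite -subr_eq0 /up (@zpointB1 i).
    by rewrite eqxx scaler_eq0 (negPf (g_neq0 i)) orbF subr_eq0 => /eqP.
  move=> j ji; rewrite (negPf ji) (fixed _ _ mu ji) (fixed _ _ mv ji).
  by rewrite -mulrDl subrK mul1r.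
(* Both 0 and 1 are convex combinations of [tu i] and [tv i], which lie in [0, 1]; hence these are 0
   and 1 in some order. *)
have ends : (tu i == 0) && (tv i == 1) || (tu i == 1) && (tv i == 0).
  have := @upf i 1 ci; rewrite ler01 lexx -fE => /(_ isT)[s1 /= /andP[s10 s11]].
  move=> /esym/upE E1.
  have := @upf i 0 ci; rewrite ler01 lexx -fE => /(_ isT)[s0 /= /andP[s00 s01]].
  move=> /esym/upE E0.
  have /andP[u0 u1] := cu i; have /andP[v0 v1] := cv i.
  have [uv'|vu'] := lerP (tu i) (tv i).
    have -> : tu i = 0.
      have : s0 * tu i <= s0 * tv i by rewrite ler_wpM2l.
      nra.
    have -> : tv i = 1; last by rewrite !eqxx.
    have : (1 - s1) * tu i <= (1 - s1) * tv i by rewrite ler_wpM2l// subr_ge0.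
    nra.
  have -> : tv i = 0.
    have : (1 - s0) * tv i <= (1 - s0) * tu i by rewrite ler_wpM2l ?subr_ge0// ltW.
    nra.
  have -> : tu i = 1; last by rewrite !eqxx orbT.
  have : s1 * tv i <= s1 * tu i by rewrite ler_wpM2l// ltW.
  nra.
have tub : tu i = (tu i == 1)%:R.
  by case/orP: ends => /andP[/eqP -> _]; rewrite ?eqxx// eq_sym oner_eq0.
have tvb : tv i = (tv i == 1)%:R.
  by case/orP: ends => /andP[_ /eqP ->]; rewrite ?eqxx// eq_sym oner_eq0.
exists (fun j => if j == i then tu i == 1 else sgnvec c j).
exists (fun j => if j == i then tv i == 1 else sgnvec c j).
split.
- move=> t ct tu'; apply/funext => j.
  have mt : maximizes c t by apply/zfaceP; rewrite ?tu'.
  case: (eqVneq j i) => [->|ji]; last exact: fixed.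
  rewrite -tub; move: tu'; rewrite -tuu => /eqP; rewrite -subr_eq0 (@zpointB1 i).
    by rewrite scaler_eq0 (negPf (g_neq0 i)) orbF subr_eq0 => /eqP.
  by move=> k ki; rewrite !fixed.
- rewrite -tvv; congr zpoint; apply/funext => j.
  by case: (eqVneq j i) => [->|ji]; [exact: tvb|exact: fixed].
- rewrite -(card1 i); apply: subset_leq_card; apply/fintype.subsetP => j.
  by rewrite !inE; case: (eqVneq j i) => // _; rewrite eqxx.
Qed.

(** Each edge changes at most one sign; this is the lower bound for graph distances. *)
Lemma walk_hamming s u v e : is_walk zonotope u s v -> u = boolpt e ->
  exists2 f, v = boolpt f & (hamming e f <= size s)%N.
Proof.
elim: s u e => [|w s IH] u e [/= p l] uE.
  exists e; first by rewrite -l.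
  by rewrite /hamming eq_card0// => i; rewrite !inE eqxx.
case/andP: p => /asboolP /edgeP[e' [f [He wE ef]]] p.
have ee' : e = e'.
  have := He _ (unit_cube_bool e) (esym uE) => E; apply/funext => i.
  move: (congr1 (fun f => f i) E) => /eqP; rewrite eqr_nat.
  by case: (e i) (e' i) => [] [].
subst e'.
have [f' vE ff'] := IH w f (conj p l) wE.
exists f' => //; apply: leq_trans (hamming_trans e f f') _.
by rewrite -[(size _).+1]add1n leq_add.
Qed.

End Zonotope.

(** * Shortest walks and the diameter of a zonotope *)

Section ZonotopeGraph.
Context {R : realType} {d n : nat}.
Variables a g : 'I_n -> 'rV[R]_d.
Hypothesis g_neq0 : forall i, g i != 0.
Hypothesis g_free : forall i j, i != j -> free [:: g i; g j].
Implicit Types (c : 'rV[R]_d).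

(* The functionals on the segment from [c] to [c''] cross the hyperplanes
   orthogonal to the generators one at a time. *)
Lemma separate_crossings c c' :
  (forall i, dotp c (g i) != 0) -> (forall i, dotp c' (g i) != 0) ->
  exists c'', (forall i, Num.sg (dotp c'' (g i)) = Num.sg (dotp c' (g i))) /\
    forall i j, i != j ->
      dotp c (g i) * dotp c'' (g j) != dotp c (g j) * dotp c'' (g i).
Proof.
move=> c0 c'0.
(* A functional on the segment from [c] to [c''] can vanish on both [g i] and [g j] only if
   [dotp c'' (h i j) = 0]. Independence makes [h i j] nonzero, so a generic [w] avoids this. *)
pose h i j := dotp c (g i) *: g j - dotp c (g j) *: g i.
pose s := [seq h p.1 p.2 | p : 'I_n * 'I_n in [pred p | p.1 != p.2]].
have hs i j : i != j -> h i j \in s.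
  by move=> ij; apply/fintype.imageP; exists (i, j).
have h0 x : x \in s -> x != 0.
  move=> /fintype.imageP[[i j]]; rewrite inE/= => ij ->; apply/eqP => E.
  have /free2P/(_ (- dotp c (g j)) (dotp c (g i))) := g_free ij.
  rewrite scaleNr addrC => /(_ E)[_ /eqP].
  by rewrite (negPf (c0 i)).
have [w Hw] := generic_functional h0.
have [c'' Hc] := perturb_functional ([seq g i | i <- enum 'I_n] ++ s) c' w.
exists c''; split=> [i|i j ij].
  by rewrite Hc ?(negPf (c'0 i))// mem_cat map_f ?mem_enum.
rewrite -subr_eq0 -!dotpZr -dotpBr -/(h i j) -sgr_eq0 Hc ?mem_cat ?hs ?orbT//.
by case: ifPn; rewrite sgr_eq0 => // _; apply: Hw; exact: hs.
Qed.

(** Moving from [c] toward [c'], stop at the first hyperplane crossed, that of [g i]: the functional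
    there exposes an edge, and one slightly beyond exposes its other end. *)
Lemma crossing_step c c' :
  (forall i, dotp c (g i) != 0) -> (forall i, dotp c' (g i) != 0) ->
  (forall i j, i != j ->
    dotp c (g i) * dotp c' (g j) != dotp c (g j) * dotp c' (g i)) ->
  (exists i, sgnvec g c i != sgnvec g c' i) ->
  exists i c2, [/\ sgnvec g c i != sgnvec g c' i,
    forall j, dotp c2 (g j) != 0, sgnvec g c2 = flip i (sgnvec g c) &
    spans_edge (zonotope a g) (boolpt a g (sgnvec g c)) (boolpt a g (sgnvec g c2))].
Proof.
move=> c0 c'0 sep [i0 i0D].
pose al i := dotp c (g i); pose be i := dotp c' (g i).
have opp i : sgnvec g c i != sgnvec g c' i ->
    (0 < al i) && (be i < 0) || (al i < 0) && (0 < be i).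
  rewrite /sgnvec -/(al i) -/(be i); have := c0 i; have := c'0 i.
  rewrite -/(al i) -/(be i); move: (al i) (be i) => x y y0 x0.
  by case: (ltrgt0P x) x0 => //= _ _; case: (ltrgt0P y) y0.
have same i : sgnvec g c i = sgnvec g c' i ->
    (0 < al i) && (0 < be i) || (al i < 0) && (be i < 0).
  rewrite /sgnvec -/(al i) -/(be i); have := c0 i; have := c'0 i.
  rewrite -/(al i) -/(be i); move: (al i) (be i) => x y y0 x0.
  by case: (ltrgt0P x) x0 => //= _ _; case: (ltrgt0P y) y0.
(* The time at which the segment from [c] to [c'] meets the hyperplane orthogonal to [g i]. *)
pose tau i := al i / (al i - be i).
pose i := [arg min_(i < i0 | sgnvec g c i != sgnvec g c' i) tau i]%O.
have [iD imin] : sgnvec g c i != sgnvec g c' i /\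
    forall j, sgnvec g c j != sgnvec g c' j -> tau i <= tau j.
  by rewrite /i; case: arg_minP.
move: i iD imin => i iD imin {i0 i0D}.
have tauE j : sgnvec g c j != sgnvec g c' j -> tau j * (al j - be j) = al j.
  move=> /opp jD; rewrite /tau divfK// subr_eq0; apply/eqP => E.
  by move: jD; rewrite E => /orP[] /andP[]; lra.
have tau01 : 0 < tau i < 1.
  have := opp i iD; have := tauE i iD.
  move: (tau i) (al i) (be i) => t x y E /orP[] /andP[x0 y0]; apply/andP; split; nra.
(* By [sep] no two crossings are simultaneous, so the first one is strictly first. *)
have {}imin j : j != i -> sgnvec g c j != sgnvec g c' j -> tau i < tau j.
  move=> ji jD; rewrite lt_neqAle imin// andbT; apply: contraNN (sep j i ji).
  have := tauE i iD; have := tauE j jD.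
  rewrite -/(al i) -/(be i) -/(al j) -/(be j) => Ej Ei /eqP E; apply/eqP.
  move: Ej Ei; rewrite -E; case/andP: tau01 => /lt0r_neq0/mulfI tI _ Ej Ei.
  have {}Ei : tau i * be i = tau i * al i - al i by rewrite -[X in _ - X]Ei; ring.
  have {}Ej : tau i * be j = tau i * al j - al j by rewrite -[X in _ - X]Ej; ring.
  by apply: tI; rewrite mulrCA Ei [RHS]mulrCA Ej; ring.
pose cs := c + tau i *: (c' - c).
have csE j : dotp cs (g j) = al j + tau i * (be j - al j).
  by rewrite dotpDl dotpZl dotpBl.
have csi : dotp cs (g i) = 0.
  by rewrite csE -(opprB (al i)) mulrN tauE// subrr.
have csj j : j != i -> Num.sg (dotp cs (g j)) = Num.sg (al j).
  move=> ji; rewrite csE; case/andP: tau01 => t0 t1.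
  have [/same|jD] := eqVneq (sgnvec g c j) (sgnvec g c' j).
    case/orP => /andP[aj bj].
      by rewrite !gtr0_sg//; nra.
    by rewrite !ltr0_sg//; nra.
  have tij := imin j ji jD; have := tauE j jD.
  case/orP: (opp j jD) => /andP[aj bj] E.
    by rewrite !gtr0_sg//; nra.
  by rewrite !ltr0_sg//; nra.
have [c2 Hc2] := perturb_functional [seq g i | i <- enum 'I_n] cs c'.
have {}Hc2 j : Num.sg (dotp c2 (g j)) = if j == i then Num.sg (be i) else Num.sg (al j).
  rewrite Hc2; last by rewrite map_f// mem_enum.
  have [->|ji] := eqVneq j i; first by rewrite csi eqxx.
  by rewrite csj// -sgr_eq0 csj// sgr_eq0 (negPf (c0 j)).
have sgn2 : sgnvec g c2 = flip i (sgnvec g c).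
  apply/funext => j; rewrite /sgnvec /flip -(sgr_gt0 (dotp c2 _)) Hc2.
  have [->|ji]/= := eqVneq j i; last by rewrite sgr_gt0.
  rewrite sgr_gt0 -/(al i).
  by case/orP: (opp i iD) => /andP[h1 h2]; rewrite (lt_gtF h1) h2 || rewrite h1 (lt_gtF h2).
exists i, c2; split=> //.
  by move=> j; rewrite -sgr_eq0 Hc2; case: ifP => _; rewrite sgr_eq0 ?c0 ?c'0.
rewrite sgn2; apply: (@edge_flip _ _ _ _ _ g_neq0 cs) => // j ji.
have sgj := csj j ji; split; first by rewrite (sgr_eq_eq0 sgj) c0.
by rewrite /sgnvec (sgr_eq_gt0 sgj).
Qed.

(** Each step flips a sign in which the ends differ. The target is first replaced by a functional
    with the same signs and separate crossings; this is redone at every step, since the crossings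
    depend on the current start. *)
Lemma walk_exists c c' :
  (forall i, dotp c (g i) != 0) -> (forall i, dotp c' (g i) != 0) ->
  exists2 s, is_walk (zonotope a g) (boolpt a g (sgnvec g c)) s (boolpt a g (sgnvec g c'))
    & size s = hamming (sgnvec g c) (sgnvec g c').
Proof.
move: {2}(hamming _ _) (erefl (hamming (sgnvec g c) (sgnvec g c'))) => m.
elim: m c c' => [|m IH] c c' Hm c0 c'0.
  exists [::]; last by rewrite Hm.
  split=> //=; congr boolpt; apply/funext => i; apply/eqP.
  by move/card0_eq: Hm => /(_ i); rewrite inE => /negbFE.
have [c'' [sg'' sep]] := separate_crossings c0 c'0.
have c''0 i : dotp c'' (g i) != 0 by rewrite (sgr_eq_eq0 (sg'' i)) c'0.
have E'' : sgnvec g c'' = sgnvec g c'.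
  by apply/funext => i; rewrite /sgnvec (sgr_eq_gt0 (sg'' i)).
rewrite -E'' in Hm *.
have [|i [c2 [iD c20 sgn2 edge]]] := crossing_step c0 c''0 sep.
  have : (0 < #|[pred i | sgnvec g c i != sgnvec g c'' i]|)%N by rewrite -/(hamming _ _) Hm.
  by move=> /card_gt0P[i]; rewrite inE; exists i.
have Hm2 : hamming (sgnvec g c2) (sgnvec g c'') = m.
  by apply: succn_inj; rewrite -Hm sgn2 -hamming_flip.
have [s [ps ls] ss] := IH _ _ Hm2 c20 c''0.
exists (boolpt a g (sgnvec g c2) :: s); last by rewrite /= ss Hm Hm2.
by split=> //=; rewrite ps andbT; apply/asboolP.
Qed.

Lemma zonotope_distance c c' :
  (forall i, dotp c (g i) != 0) -> (forall i, dotp c' (g i) != 0) ->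
  is_graph_distance (zonotope a g) (boolpt a g (sgnvec g c)) (boolpt a g (sgnvec g c'))
    (hamming (sgnvec g c) (sgnvec g c')).
Proof.
move=> c0 c'0; split=> [|s]; first exact: walk_exists.
move=> /(walk_hamming g_neq0 g_free)/(_ erefl)[f fE].
by rewrite -(boolpt_generic_inj c'0 (esym fE)).
Qed.

Lemma zonotope_diameter : has_diameter (zonotope a g) n.
Proof.
split=> [u v|].
  move=> /(vertexP g_neq0)[c c0 ->] /(vertexP g_neq0)[c' c'0 ->].
  exists (hamming (sgnvec g c) (sgnvec g c')); first exact: zonotope_distance.
  by rewrite (leq_trans (max_card _))// card_ord.
have [|c Hc] := @generic_functional _ _ [seq g i | i <- enum 'I_n].
  by move=> _ /mapP[i _ ->].
have c0 i : dotp c (g i) != 0 by apply: Hc; rewrite map_f ?mem_enum.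
have Nc0 i : dotp (- c) (g i) != 0 by rewrite dotpNl oppr_eq0.
(* A generic functional and its opposite disagree in all [n] signs. *)
exists (boolpt a g (sgnvec g c)), (boolpt a g (sgnvec g (- c))).
split; [exact: vertex_generic|exact: vertex_generic|].
have := zonotope_distance c0 Nc0.
suff -> : hamming (sgnvec g c) (sgnvec g (- c)) = n by [].
rewrite -[RHS](hamming_negb (sgnvec g c)); congr hamming; apply/funext => i.
rewrite /sgnvec dotpNl oppr_gt0; have := c0 i.
by case: ltrgt0P.
Qed.

(** A functional orthogonal to [g i] and to no other generator is tilted by plus and minus [g i];
    the two vertices obtained differ in the [i]-th sign only. This carries integrality from the
    vertices to the generators. *)
Lemma generator_vertices i : exists u v,
  [/\ is_vertex (zonotope a g) u, is_vertex (zonotope a g) v & u - v = g i].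
Proof.
(* Up to the factor [dotp (g i) (g i)], [h j] is the projection of [g j] orthogonal to [g i]. Below,
   [c] is the same projection of [w], and [dotp c (g j) = dotp w (h j)]. *)
pose h j := dotp (g i) (g i) *: g j - dotp (g i) (g j) *: g i.
have gi0 : dotp (g i) (g i) != 0 by rewrite dotp_eq0.
have [|w Hw] := @generic_functional _ _ [seq h j | j in [pred j | j != i]].
  move=> x /fintype.imageP[j]; rewrite inE => ji ->; apply/eqP => E.
  have /free2P/(_ (dotp (g i) (g i)) (- dotp (g i) (g j))) := g_free ji.
  by rewrite scaleNr => /(_ E)[/eqP]; rewrite (negPf gi0).
pose c := dotp (g i) (g i) *: w - dotp w (g i) *: g i.
have ci : dotp c (g i) = 0.
  by rewrite dotpBl !dotpZl mulrC subrr.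
have cj j : j != i -> dotp c (g j) != 0.
  move=> ji; have : dotp w (h j) != 0 by apply: Hw; apply/fintype.imageP; exists j.
  by rewrite dotpBr !dotpZr dotpBl !dotpZl [dotp w (g i) * _]mulrC.
have E (e : R) : e != 0 -> exists c', forall j, Num.sg (dotp c' (g j)) =
    if j == i then Num.sg e else Num.sg (dotp c (g j)).
  move=> e0; have [c' Hc'] := perturb_functional [seq g i | i <- enum 'I_n] c (e *: g i).
  exists c' => j; rewrite Hc'; last by rewrite map_f// mem_enum.
  have [->|ji] := eqVneq j i; last by rewrite (negPf (cj j ji)).
  by rewrite ci eqxx dotpZl sgrM (gtr0_sg (dotp_gt0 _))// mulr1.
have gen (e : R) (c' : 'rV_d) : e != 0 -> (forall j, Num.sg (dotp c' (g j)) =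
    if j == i then Num.sg e else Num.sg (dotp c (g j))) ->
    forall j, dotp c' (g j) != 0.
  move=> e0 H j; rewrite -sgr_eq0 H.
  by have [_|ji] := eqVneq j i; rewrite sgr_eq0// cj.
have N10 : (-1 : R) != 0 by rewrite oppr_eq0 oner_eq0.
have [c1 H1] := E 1 (oner_neq0 _); have [c2 H2] := E (-1) N10.
exists (boolpt a g (sgnvec g c1)), (boolpt a g (sgnvec g c2)).
split; [exact: vertex_generic (gen 1 _ (oner_neq0 _) H1)|
  exact: vertex_generic (gen (-1) _ N10 H2)|].
rewrite (@zpointB1 _ _ _ _ _ i).
  rewrite /sgnvec -(sgr_gt0 (dotp c1 _)) -(sgr_gt0 (dotp c2 _)) H1 H2 eqxx.
  by rewrite !sgr_gt0 ltr01 oppr_gt0 ltr10 subr0 scale1r.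
move=> j /negPf ji; rewrite /sgnvec -(sgr_gt0 (dotp c1 _)) -(sgr_gt0 (dotp c2 _)).
by rewrite H1 H2 ji.
Qed.

End ZonotopeGraph.

Lemma has_diameter_le (R : realType) (d m n : nat) (P : set 'rV[R]_d) :
  has_diameter P m -> has_diameter P n -> (m <= n)%N.
Proof.
move=> [_ [u [v [vu vv [_ dm]]]]] [/(_ u v vu vv)[k [[s ws <-] _] kn] _].
exact: leq_trans (dm s ws) kn.
Qed.

(** * Zonotopes as Minkowski sums and as polytopes *)

Lemma minkowski_zonotope (R : realType) (d n : nat) (a b : 'I_n -> 'rV[R]_d) :
  minkowski_sum (fun i => segment (a i) (b i)) =
  zonotope a (fun i => b i - a i).
Proof.
apply/seteqP; split=> x.
  case=> p Hp ->.
  have /choice[t Ht] : forall i, exists t : R, 0 <= t <= 1 /\ p i = (1 - t) *: a i + t *: b i.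
    by move=> i; have [t t01 <-] := Hp i; exists t.
  exists t => [i|]; first by have [] := Ht i.
  apply: eq_bigr => i _; have [_ ->] := Ht i.
  by apply/rowP => k; rewrite !mxE; ring.
case=> t ct <-; exists (fun i => a i + t i *: (b i - a i)) => // i.
exists (t i); first exact: ct.
by apply/rowP => k; rewrite !mxE; ring.
Qed.

Lemma zonotope_convex (R : realType) (d n : nat) (a g : 'I_n -> 'rV[R]_d) :
  convex_set (zonotope a g).
Proof.
move=> x y l; rewrite !inE => -[t ct <-] [t' ct' <-].
exists (fun i => (1 - l%:num) * t' i + l%:num * t i); last first.
  by rewrite -zpoint_conv addrC.
move=> i; have /andP[t0 t1] := ct i; have /andP[t'0 t'1] := ct' i.
have l0 : 0 <= l%:num by []. have l1 : l%:num <= 1 by [].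
by apply/andP; split; nra.
Qed.

(* Each coordinate of the parameter in turn is replaced by [0] and [1]. *)
Lemma zonotope_polytope (R : realType) (d n : nat) (a g : 'I_n -> 'rV[R]_d) :
  is_polytope (zonotope a g).
Proof.
exists [set boolpt a g e | e in [set: {ffun 'I_n -> bool}]].
  exact/finite_image/finite_finset.
apply/seteqP; split; last first.
  apply: smallest_sub; first exact: zonotope_convex.
  by move=> _ [e _ <-]; exists (fun i => (e i)%:R) => //; exact: unit_cube_bool.
move=> _ [t ct <-] B [cB AB].
(* Only the first [m] parameters may differ from 0 and 1. *)
suff H m : forall t, unit_cube t ->
    (forall i : 'I_n, (m <= i)%N -> (t i == 0) || (t i == 1)) -> B (zpoint a g t).
  by apply: (H n) => // i; rewrite leqNgt ltn_ord.
elim: m => [|m IH] {ct}t ct Ht.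
  apply: AB; exists [ffun i => t i == 1] => //; congr zpoint; apply/funext => i.
  rewrite ffunE; have := Ht i (leq0n _) => /orP[] /eqP ->; rewrite ?eqxx//.
  by rewrite eq_sym oner_eq0.
have [mn|mn] := ltnP m n; last first.
  by apply: IH => // i; rewrite leqNgt (leq_trans (ltn_ord i)).
pose i := Ordinal mn.
have K (z : R) : (z == 0) || (z == 1) ->
    B (zpoint a g (fun j => if j == i then z else t j)).
  move=> z01; apply: IH.
    by apply: unit_cube_upd => //; case/orP: z01 => /eqP ->; rewrite ?lexx ?ler01.
  move=> j mj; case: ifPn => // ji; apply: Ht.
  by rewrite ltn_neqAle mj andbT; apply: contraNneq ji => mE; apply/eqP/val_inj.
have /andP[t0 t1] := ct i.
have := cB _ _ (Itv01 t0 t1) (mem_set (K 1 _)) (mem_set (K 0 _)).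
rewrite !eqxx orbT => /(_ isT isT); rewrite inE.
congr B; rewrite [LHS]addrC; rewrite [LHS]zpoint_conv; congr zpoint.
apply/funext => j /=; case: eqP => [->|_]; first by rewrite mulr0 add0r mulr1.
by rewrite -mulrDl subrK mul1r.
Qed.

(** * Integer points of the cross-polytope *)

Section LatticePoints.
Local Open Scope nat_scope.
Implicit Types d r m : nat.

Definition norm1 d (v : 'rV[int]_d) : nat := \sum_i `|v ord0 i|%N.

(** Primitive vectors are those of content 1; the zero vector has content 0, so it is not among
    them. *)
Definition vcontent d (v : 'rV[int]_d) : nat := \big[gcdn/0]_i `|v ord0 i|%N.

Definition int_ball r : seq int :=
  [seq Posz j | j <- iota 0 r.+1] ++ [seq (- Posz j.+1)%R | j <- iota 0 r].

Fixpoint ball1 d r : seq 'rV[int]_d :=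
  if d is d'.+1 then
    [seq (row_mx (const_mx j : 'rV[int]_1) w : 'rV[int]_d'.+1)
       | j <- int_ball r, w <- ball1 d' (r - `|j|)]
  else [:: 0%R].

Definition prim_ball d r := [seq v <- ball1 d r | vcontent v == 1].

(* One vector out of each pair [v], [- v]. *)
Definition half_prim_ball d r :=
  [seq v <- prim_ball d r | pickle v < pickle (- v)%R].

Lemma mem_int_ball r (x : int) : (x \in int_ball r) = (`|x| <= r).
Proof.
rewrite mem_cat; apply/orP/idP => [[] /mapP[j]|].
- by rewrite mem_iota => jr ->.
- by rewrite mem_iota => jr ->; rewrite abszN.
case: x => j jr; [left|right]; apply/mapP; exists j; rewrite ?mem_iota ?NegzE//.
Qed.

Lemma uniq_int_ball r : uniq (int_ball r).
Proof.
rewrite cat_uniq !map_inj_uniq ?iota_uniq; last first.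
- by move=> x y [].
- by move=> x y /oppr_inj [].
rewrite andbT /=; apply/hasPn => _ /mapP[j _ ->]; apply/mapP => -[k _].
by case: k.
Qed.

Lemma norm1_row_mx d (j : int) (w : 'rV[int]_d) :
  norm1 (row_mx (const_mx j : 'rV_1) w : 'rV_d.+1) = `|j| + norm1 w.
Proof.
rewrite /norm1 (@big_split_ord _ _ _ 1 d) big_ord1; congr (_ + _).
  by rewrite (@row_mxEl _ 1 1 d) mxE.
by apply: eq_bigr => i _; rewrite (@row_mxEr _ 1 1 d).
Qed.

Lemma mem_ball1 d r (v : 'rV[int]_d) : (v \in ball1 d r) = (norm1 v <= r).
Proof.
elim: d r v => [|d IH] r v; first by rewrite thinmx0 inE /norm1 big_ord0 leq0n eqxx.
apply/allpairsPdep/idP => [[j [w [jr wr ->]]]|].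
  by rewrite norm1_row_mx -leq_subRL -?IH// -mem_int_ball.
rewrite -[v](@hsubmxK _ 1 1 d).
have -> : @lsubmx _ 1 1 d v = const_mx (@lsubmx _ 1 1 d v ord0 ord0).
  by apply/matrixP => i k; rewrite !mxE !ord1.
move: (lsubmx _ _ _) (rsubmx _) => j w; rewrite norm1_row_mx => H.
have jr : `|j| <= r by apply: leq_trans H; exact: leq_addr.
by exists j, w; rewrite mem_int_ball IH leq_subRL.
Qed.

Lemma uniq_ball1 d r : uniq (ball1 d r).
Proof.
elim: d r => [//|d IH] r.
apply: (@allpairs_uniq_dep _ (fun _ => _)) => [||[j w] [j' w'] _ _ /=].
- exact: uniq_int_ball.
- by move=> j _; exact: IH.
move=> /(@eq_row_mx _ 1 1 d)[/matrixP/(_ ord0 ord0)]; rewrite !mxE => -> ->.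
by [].
Qed.

Lemma sum_iota_ord n (F : nat -> nat) : \sum_(i <- iota 0 n) F i = \sum_(i < n) F i.
Proof. by rewrite -(big_mkord xpredT) /index_iota subn0. Qed.

(** A first coordinate [j] leaves the radius [s = r - |j|]; nonnegative [j] give the first sum,
    negative ones the second. *)
Lemma size_ball1S d r : size (ball1 d.+1 r) =
  \sum_(s < r.+1) size (ball1 d s) + \sum_(s < r) size (ball1 d s).
Proof.
rewrite size_allpairs_dep sumnE big_map big_cat !big_map !sum_iota_ord; congr (_ + _).
  rewrite (reindex_inj rev_ord_inj)/=.
  by apply: eq_bigr => i _; rewrite subSS subKn// -ltnS.
rewrite (reindex_inj rev_ord_inj).
apply: eq_bigr => i _; rewrite abszN absz_nat /= -subSn ?subSS; last exact: ltn_ord.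
by rewrite subKn// ltnW.
Qed.

Lemma sum_bin_upper d r : \sum_(s < r) 'C(s, d) = 'C(r, d.+1).
Proof.
elim: r => [|r IH]; first by rewrite big_ord0 bin0n.
by rewrite big_ord_recr/= IH binS addnC.
Qed.

Lemma sum_bin_upper_shift d r : \sum_(s < r) 'C(s + d, d) = 'C(r + d, d.+1).
Proof.
elim: r => [|r IH]; first by rewrite big_ord0 bin_small.
by rewrite big_ord_recr/= IH addSn binS addnC.
Qed.

(** Here and in [size_ball1_le] the two slice sums are made equal by dropping or adding a term, and
    the hockey-stick identity applies. Both bounds have leading term [(2 r)^d / d!]. *)
Lemma size_ball1_ge d r : 2 ^ d * 'C(r, d) <= size (ball1 d r).
Proof.
elim: d r => [|d IH] r; first by rewrite bin0.
rewrite size_ball1S -sum_bin_upper expnS -mulnA mul2n -addnn.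
apply: leq_add; last by rewrite big_distrr/= leq_sum.
by rewrite big_distrr/= big_ord_recr/= (leq_trans _ (leq_addr _ _))// leq_sum.
Qed.

Lemma size_ball1_le d r : size (ball1 d r) <= 2 ^ d * 'C(r + d, d).
Proof.
elim: d r => [|d IH] r; first by rewrite bin0.
rewrite size_ball1S addnS -addSn -sum_bin_upper_shift expnS -mulnA mul2n -addnn.
apply: leq_add; first by rewrite big_distrr/= leq_sum.
by rewrite big_distrr/= [leqRHS]big_ord_recr/= (leq_trans _ (leq_addr _ _))// leq_sum.
Qed.

Lemma norm1N d (v : 'rV[int]_d) : norm1 (- v)%R = norm1 v.
Proof. by apply: eq_bigr => i _; rewrite mxE abszN. Qed.

Lemma vcontentN d (v : 'rV[int]_d) : vcontent (- v)%R = vcontent v.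
Proof. by apply: eq_bigr => i _; rewrite mxE abszN. Qed.

Lemma norm1Z d m (v : 'rV[int]_d) : norm1 (Posz m *: v)%R = m * norm1 v.
Proof. by rewrite /norm1 big_distrr/=; apply: eq_bigr => i _; rewrite mxE abszM. Qed.

Lemma biggcdn_mull (I : finType) (F : I -> nat) m :
  \big[gcdn/0]_i (m * F i) = m * \big[gcdn/0]_i F i.
Proof.
by apply/esym/(big_morph (muln m)) => [x y|]; rewrite ?muln0// muln_gcdr.
Qed.

Lemma vcontentZ d m (v : 'rV[int]_d) : vcontent (Posz m *: v)%R = m * vcontent v.
Proof. by rewrite /vcontent -biggcdn_mull; apply: eq_bigr => i _; rewrite mxE abszM. Qed.

Lemma vcontent0 d : vcontent (0%R : 'rV[int]_d) = 0.
Proof. by rewrite /vcontent big1// => i _; rewrite mxE. Qed.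

Lemma norm10 d : norm1 (0%R : 'rV[int]_d) = 0.
Proof. by rewrite /norm1 big1// => i _; rewrite mxE. Qed.

Lemma norm1_eq0 d (v : 'rV[int]_d) : (norm1 v == 0) = (v == 0%R).
Proof.
apply/idP/eqP => [|->]; last by rewrite norm10.
rewrite sum_nat_eq0 => /forallP H; apply/rowP => i; apply/eqP.
by rewrite mxE -absz_eq0; have := H i.
Qed.

Lemma vcontent_eq0 d (v : 'rV[int]_d) : (vcontent v == 0) = (v == 0%R).
Proof.
apply/idP/eqP => [|->]; last by rewrite vcontent0.
rewrite -dvd0n => /dvdn_biggcdP H; apply/rowP => i; apply/eqP.
by rewrite mxE -absz_eq0 -dvd0n H.
Qed.

Lemma vcontent_divK d (v : 'rV[int]_d) : v != 0%R ->
  exists2 w : 'rV[int]_d, vcontent w = 1 & v = (Posz (vcontent v) *: w)%R.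
Proof.
rewrite -vcontent_eq0 -lt0n => c0.
have vE : v = (Posz (vcontent v) *: (\row_i (v ord0 i %/ Posz (vcontent v))%Z))%R.
  apply/rowP => i; rewrite !mxE mulrC divzK// dvdzE /=.
  exact: (biggcdn_inf i).
exists (\row_i (v ord0 i %/ Posz (vcontent v))%Z)%R => //.
apply/eqP; rewrite -(eqn_pmul2l c0) muln1 -vcontentZ -vE//.
Qed.

Lemma mem_prim_ball d r (v : 'rV[int]_d) :
  (v \in prim_ball d r) = (vcontent v == 1) && (norm1 v <= r).
Proof. by rewrite mem_filter mem_ball1. Qed.

(** A nonzero vector is uniquely its content [m.+1] times a primitive vector, of norm at most
    [r %/ m.+1]; the 1 counts the zero vector. *)
Lemma size_ball1_prim d r :
  size (ball1 d r) = 1 + \sum_(m < r) size (prim_ball d (r %/ m.+1)).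
Proof.
pose s := [seq (Posz m.+1 *: v)%R | m <- iota 0 r, v <- prim_ball d (r %/ m.+1)].
have -> : \sum_(m < r) size (prim_ball d (r %/ m.+1)) = size s.
  by rewrite size_allpairs_dep sumnE big_map sum_iota_ord.
suff /perm_size -> : perm_eq (ball1 d r) (0%R :: s) by [].
apply: uniq_perm; first exact: uniq_ball1.
  rewrite cons_uniq; apply/andP; split.
    apply/allpairsPdep => -[m [v [_ ]]]; rewrite mem_prim_ball => /andP[/eqP v1 _].
    by move=> /(congr1 (@vcontent d)); rewrite vcontentZ v1 vcontent0.
  apply: (@allpairs_uniq_dep _ (fun _ => 'rV[int]_d : eqType)) => [||p p'].
  - exact: iota_uniq.
  - by move=> j _; rewrite filter_uniq// uniq_ball1.
  move=> /allpairsPdep[m [v [_ + ->]]]; rewrite mem_prim_ball => /andP[/eqP v1 _].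
  move=> /allpairsPdep[m' [v' [_ + ->]]]; rewrite mem_prim_ball => /andP[/eqP v'1 _].
  move=> /= E.
  have mm : m = m'.
    by move: (congr1 (@vcontent d) E); rewrite !vcontentZ v1 v'1 !muln1 => -[].
  rewrite mm in E *; suff -> : v = v' by [].
  apply/rowP => i; move/rowP/(_ i): E; rewrite !mxE; exact: mulfI.
move=> v; rewrite mem_ball1 inE; apply/idP/orP => [vr|[/eqP ->|]].
- have [->|v0] := eqVneq v 0%R; [by left|right].
  have [w w1 vE] := vcontent_divK v0; apply/allpairsPdep.
  have c0 : 0 < vcontent v by rewrite lt0n vcontent_eq0.
  exists (vcontent v).-1, w; rewrite prednK//; split=> //.
    rewrite mem_iota add0n prednK// (leq_trans _ vr)// {2}vE norm1Z.
    by rewrite leq_pmulr// lt0n norm1_eq0 -vcontent_eq0 w1.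
  by rewrite mem_prim_ball w1 eqxx/= leq_divRL// mulnC -norm1Z -vE.
- by rewrite norm10.
- move=> /allpairsPdep[m [w [mr]]]; rewrite mem_prim_ball => /andP[_ wr] ->.
  by rewrite norm1Z mulnC -leq_divRL.
Qed.

End LatticePoints.

(** * Primitive vectors up to sign, and the packing bound *)

Section PrimitiveVectors.
Local Open Scope nat_scope.
Implicit Types d r m : nat.

Lemma mem_half_prim_ball d r (v : 'rV[int]_d) : (v \in half_prim_ball d r) =
  [&& vcontent v == 1, norm1 v <= r & pickle v < pickle (- v)%R].
Proof. by rewrite mem_filter mem_prim_ball andbC -andbA. Qed.

Lemma uniq_half_prim_ball d r : uniq (half_prim_ball d r).
Proof. by rewrite !filter_uniq// uniq_ball1. Qed.

Lemma primitive_neqN d (v : 'rV[int]_d) : vcontent v = 1 -> v != (- v)%R.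
Proof.
move=> v1; apply/eqP => vN; have : v == 0%R.
  apply/eqP/rowP => i; move/rowP/(_ i): vN; rewrite !mxE => /eqP.
  by rewrite eq_sym eqNr => /eqP.
by rewrite -vcontent_eq0 v1.
Qed.

Lemma primitive_pickle d (v : 'rV[int]_d) : vcontent v = 1 ->
  (pickle v < pickle (- v)%R) || (pickle (- v)%R < pickle v).
Proof.
move=> v1; rewrite -neq_ltn; apply: contra (primitive_neqN v1) => /eqP.
by move=> /(pcan_inj pickleK) vN; exact/eqP.
Qed.

Lemma prim_ball_half d r : perm_eq (prim_ball d r)
  (half_prim_ball d r ++ [seq (- v)%R | v <- half_prim_ball d r]).
Proof.
apply: uniq_perm; first by rewrite filter_uniq// uniq_ball1.
  rewrite cat_uniq uniq_half_prim_ball map_inj_uniq ?uniq_half_prim_ball ?andbT/=; last exact: oppr_inj.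
  apply/hasPn => _ /mapP[v + ->]; rewrite !mem_half_prim_ball opprK.
  by move=> /and3P[_ _ vN]; rewrite (leq_gtF (ltnW vN)) !andbF.
move=> v; rewrite mem_cat mem_prim_ball mem_half_prim_ball.
have -> : (v \in [seq (- v)%R | v <- half_prim_ball d r]) = ((- v)%R \in half_prim_ball d r).
  by rewrite -[v in LHS]opprK mem_map//; exact: oppr_inj.
rewrite mem_half_prim_ball opprK vcontentN norm1N.
have [v1|//] := eqVneq (vcontent v) 1; case: (norm1 v <= r) => //=.
by rewrite primitive_pickle.
Qed.

Lemma sum_prim_ball_even d r (F : 'rV[int]_d -> nat) :
  (forall v, F (- v)%R = F v) ->
  \sum_(v <- prim_ball d r) F v = 2 * \sum_(v <- half_prim_ball d r) F v.
Proof.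
move=> FN; rewrite (perm_big _ (prim_ball_half d r))/= big_cat big_map mul2n -addnn.
by congr (_ + _); apply: eq_bigr => v _.
Qed.

Lemma size_prim_ball d r : size (prim_ball d r) = 2 * size (half_prim_ball d r).
Proof.
by rewrite -!sum1_size sum_prim_ball_even.
Qed.

(** Both sides count the pairs [(v, s)] with [norm1 v <= s < r]. *)
Lemma sum_half_prim_codist d r :
  \sum_(v <- half_prim_ball d r) (r - norm1 v) = \sum_(s < r) size (half_prim_ball d s).
Proof.
have H s : s < r -> size (half_prim_ball d s) =
    \sum_(v <- half_prim_ball d r) (norm1 v <= s).
  move=> sr; rewrite -big_mkcond/= sum1_count -size_filter; apply: perm_size.
  apply: uniq_perm; rewrite ?filter_uniq ?uniq_ball1// => v.
  rewrite mem_half_prim_ball mem_filter mem_half_prim_ball; case: (leqP (norm1 v) s) => [vs|]; last by rewrite andbF.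
  by rewrite (leq_trans vs (ltnW sr)).
rewrite (eq_bigr (fun s : 'I_r => \sum_(v <- half_prim_ball d r) (norm1 v <= s : nat))); last first.
  by move=> s _; rewrite H.
rewrite exchange_big/=; apply: eq_big_seq => v; rewrite mem_half_prim_ball => /and3P[_ vr _].
rewrite -big_mkcond/= sum1_card -[in LHS](card_ord (r - norm1 v)).
have f_lt (i : 'I_(r - norm1 v)) : norm1 v + i < r by rewrite -ltn_subRL.
have f_inj : injective (fun i => Ordinal (f_lt i)).
  by move=> i j /(congr1 val)/= /addnI/val_inj.
rewrite -(card_codom f_inj).
apply: eq_card => s; apply/codomP/idP => [[i ->]|vs].
  exact: leq_addr.
have sv : s - norm1 v < r - norm1 v by rewrite ltn_sub2rE.
by exists (Ordinal sv); apply/val_inj; rewrite /= subnKC.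
Qed.

Lemma sum_half_prim_norm d r :
  \sum_(v <- half_prim_ball d r) norm1 v + \sum_(s < r) size (half_prim_ball d s) =
  r * size (half_prim_ball d r).
Proof.
rewrite -sum_half_prim_codist -big_split/= mulnC -sum1_size big_distrl/=.
apply: eq_big_seq => v; rewrite mem_half_prim_ball => /and3P[_ vr _].
by rewrite subnKC// mul1n.
Qed.

Lemma norm1_xcol d (i j : 'I_d) (v : 'rV[int]_d) : norm1 (xcol i j v) = norm1 v.
Proof.
rewrite /norm1 [RHS](reindex_inj (@perm_inj _ (tperm i j))).
by apply: eq_bigr => k _; rewrite mxE.
Qed.

Lemma vcontent_xcol d (i j : 'I_d) (v : 'rV[int]_d) : vcontent (xcol i j v) = vcontent v.
Proof.
rewrite /vcontent [RHS](reindex_inj (@perm_inj _ (tperm i j))).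
by apply: eq_bigr => k _; rewrite mxE.
Qed.

Lemma xcolK d (i j : 'I_d) : involutive (@xcol int 1 d i j).
Proof. by move=> v; apply/rowP => k; rewrite !mxE tpermK. Qed.

(** Swapping two coordinates permutes the ball. It need not respect the choice of signs in
    [half_prim_ball], hence the full ball here. *)
Lemma sum_prim_ball_coord d r (i j : 'I_d) :
  \sum_(v <- prim_ball d r) `|v ord0 i| = \sum_(v <- prim_ball d r) `|v ord0 j|.
Proof.
rewrite [RHS](perm_big [seq xcol i j v | v <- prim_ball d r])/=.
  by rewrite big_map; apply: eq_bigr => v _; rewrite mxE tpermR.
apply: uniq_perm; rewrite ?map_inj_uniq ?filter_uniq ?uniq_ball1//.
  exact: inv_inj (xcolK i j).
move=> v; rewrite -[v in RHS](xcolK i j) mem_map; last exact: inv_inj (xcolK i j).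
by rewrite !mem_prim_ball norm1_xcol vcontent_xcol.
Qed.

Lemma sum_half_prim_coord d r (i : 'I_d) :
  d * \sum_(v <- half_prim_ball d r) `|v ord0 i| =
  \sum_(v <- half_prim_ball d r) norm1 v.
Proof.
apply/eqP; rewrite -(eqn_pmul2l (isT : 0 < 2)) mulnCA -!sum_prim_ball_even; last first.
- by move=> v; rewrite mxE abszN.
- exact: norm1N.
apply/eqP; rewrite /norm1 exchange_big/= [RHS](eq_bigr (fun=> \sum_(v <- prim_ball d r) `|v ord0 i|)).
  by rewrite big_const_ord iter_addn_0 mulnC.
by move=> j _; exact: sum_prim_ball_coord.
Qed.

(** Since both contents are 1, [|u_i| = gcd_j |u_i v_j| = gcd_j |u_j v_i| = |v_i|]; one nonzero
    coordinate then decides the sign for all. *)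
Lemma primitive_parallel d (u v : 'rV[int]_d) : vcontent u = 1 -> vcontent v = 1 ->
  (forall i j, u ord0 i * v ord0 j = u ord0 j * v ord0 i)%R -> u = v \/ u = (- v)%R.
Proof.
move=> u1 v1 uv.
have absE i : `|u ord0 i| = `|v ord0 i|.
  transitivity (`|u ord0 i| * vcontent v); first by rewrite v1 muln1.
  transitivity (`|v ord0 i| * vcontent u); last by rewrite u1 muln1.
  by rewrite -!biggcdn_mull; apply: eq_bigr => j _; rewrite -!abszM uv mulrC.
have [i ui0] : exists i, u ord0 i != 0%R.
  apply/existsP; apply: contra_eqT u1 => /existsPn u0; suff -> : u = 0%R by rewrite vcontent0.
  by apply/rowP => i; rewrite mxE; apply/eqP/negPn.
have /orP[/eqP uvi|/eqP uvi] : (v ord0 i == u ord0 i) || (v ord0 i == - u ord0 i)%R.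
- by have := absE i; move: (u ord0 i) (v ord0 i) => x y; lia.
- left; apply/rowP => j; apply: (mulfI ui0).
  by rewrite uv uvi mulrC.
- right; apply/rowP => j; rewrite mxE; apply: (mulfI ui0).
  by rewrite mulrN uv uvi mulrN opprK mulrC.
Qed.

Lemma primitive_direction d (v : 'rV[int]_d) : v != 0%R -> exists q : 'rV[int]_d,
  [/\ vcontent q = 1, pickle q < pickle (- q)%R, norm1 q <= norm1 v &
      exists k : int, v = (k *: q)%R].
Proof.
move=> v0; have [w w1 vE] := vcontent_divK v0.
have wv : norm1 w <= norm1 v by rewrite vE norm1Z leq_pmull// lt0n vcontent_eq0.
case/orP: (primitive_pickle w1) => wN.
  by exists w; split=> //; exists (Posz (vcontent v)).
exists (- w)%R; rewrite vcontentN norm1N opprK; split=> //.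
by exists (- Posz (vcontent v))%R; rewrite scaleNr scalerN opprK.
Qed.

(** Replace each vector by the primitive one [q i] on its line and use
    [r <= norm1 q + (r - norm1 q)] with truncated subtraction. The [q i] are distinct, so the second
    terms sum to at most the corresponding sum over the half ball. The radius [r] is free, to be
    chosen later. *)
Lemma nonparallel_packing d m (G : 'I_m -> 'rV[int]_d) r : (forall i, G i != 0%R) ->
  (forall i j, i != j -> exists a b,
     (G i ord0 a * G j ord0 b != G i ord0 b * G j ord0 a)%R) ->
  m * r <= \sum_i norm1 (G i) + \sum_(s < r) size (half_prim_ball d s).
Proof.
move=> G0 Gpar.
have /choice[q Hq] := fun i => primitive_direction (G0 i).
have q_inj : injective q.
  move=> i j qij; apply/eqP/negPn/negP => /Gpar[a [b]].
  have [_ _ _ [k ->]] := Hq i; have [_ _ _ [l ->]] := Hq j.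
  by rewrite qij !mxE mulrACA [X in _ != X]mulrACA [(q j _ b * _)%R]mulrC eqxx.
apply: (@leq_trans (\sum_i norm1 (q i) + \sum_i (r - norm1 (q i)))).
  rewrite -big_split/= mulnC -iter_addn_0 -big_const_ord; apply: leq_sum => i _.
  by rewrite -leq_subLR.
apply: leq_add; first by apply: leq_sum => i _; have [] := Hq i.
rewrite -sum_half_prim_codist.
apply: (@leq_trans (\sum_(v <- [seq v <- [seq q i | i <- enum 'I_m] | norm1 v <= r]) (r - norm1 v))).
  rewrite big_filter big_map [leqRHS]big_enum_cond/= [leqLHS](bigID (fun i => norm1 (q i) <= r))/=.
  rewrite addnC big1 => [|i]; first by rewrite add0n.
  by rewrite -ltnNge => /ltnW; rewrite -subn_eq0 => /eqP.
apply: (uniq_sub_le_big leqnn (fun x y => leq_addr y x)).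
- by rewrite filter_uniq// map_inj_uniq ?enum_uniq.
- exact: uniq_half_prim_ball.
move=> v; rewrite mem_filter => /andP[vr /mapP[i _ vE]].
by have [q1 qN _ _] := Hq i; rewrite mem_half_prim_ball vr vE q1 qN.
Qed.

End PrimitiveVectors.

(** * Lattice zonotopes in the cube *)

(** Unlike [free], the minors can be compared between integer vectors and their real images. *)
Lemma free2_minorP (F : fieldType) (d : nat) (u v : 'rV[F]_d) :
  free [:: u; v] <->
  exists i j, u ord0 i * v ord0 j != u ord0 j * v ord0 i.
Proof.
split=> [/free2P uv|[i [j uv]]].
  apply: contrapT => no.
  have uv0 i j : u ord0 i * v ord0 j = u ord0 j * v ord0 i.
    by apply/eqP/negPn/negP => H; apply: no; exists i, j.
  have u0 i : u ord0 i = 0.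
    have [|] := uv (v ord0 i) (- u ord0 i); last by move=> _ /eqP; rewrite oppr_eq0 => /eqP.
    by apply/rowP => j; rewrite !mxE mulNr uv0 mulrC subrr.
  have [] := uv 1 0; last by move/eqP; rewrite oner_eq0.
  by apply/rowP => j; rewrite !mxE u0 mulr0 mul0r addr0.
have m0 : u ord0 i * v ord0 j - u ord0 j * v ord0 i != 0 by rewrite subr_eq0.
apply/free2P => x y /rowP E; have := E i; have := E j; rewrite !mxE => Ej Ei.
split; apply/eqP.
  suff : x * (u ord0 i * v ord0 j - u ord0 j * v ord0 i) == 0.
    by rewrite mulf_eq0 (negPf m0) orbF.
  have -> : x * (u ord0 i * v ord0 j - u ord0 j * v ord0 i) =
    (x * u ord0 i + y * v ord0 i) * v ord0 j - (x * u ord0 j + y * v ord0 j) * v ord0 i by ring.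
  by rewrite Ei Ej !mul0r subrr.
suff : y * (u ord0 i * v ord0 j - u ord0 j * v ord0 i) == 0.
  by rewrite mulf_eq0 (negPf m0) orbF.
have -> : y * (u ord0 i * v ord0 j - u ord0 j * v ord0 i) =
  (x * u ord0 j + y * v ord0 j) * u ord0 i - (x * u ord0 i + y * v ord0 i) * u ord0 j by ring.
by rewrite Ei Ej !mul0r subrr.
Qed.

Lemma diameters_upper (R : realType) (d k m r : nat) :
  zonotope_diameters R d k m ->
  (m * r <= d * k + \sum_(s < r) size (half_prim_ball d s))%N.
Proof.
case=> Z [[[n [a [b [ab fr ZE]]]] [_ intZ]] Zk diamZ].
rewrite minkowski_zonotope in ZE; pose g i := b i - a i.
have g0 i : g i != 0 by rewrite subr_eq0; apply/eqP/nesym.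
have gfree i j : i != j -> free [:: g i; g j] by move=> /eqP; exact: fr.
have mn : (m <= n)%N.
  by apply: has_diameter_le diamZ _; rewrite ZE; exact: zonotope_diameter.
have intg i j : g i ord0 j \is a Num.int.
  have [u [v [vu vv <-]]] := generator_vertices a g0 gfree i.
  by rewrite !mxE rpredB// intZ// ZE.
pose G i : 'rV[int]_d := \row_j Num.floor (g i ord0 j).
have GE i j : (G i ord0 j)%:~R = g i ord0 j by rewrite mxE floorK.
have minorE i j x y : (G i ord0 x * G j ord0 y == G i ord0 y * G j ord0 x) =
    (g i ord0 x * g j ord0 y == g i ord0 y * g j ord0 x).
  by rewrite -!GE -!intrM eqr_int.
apply: (@leq_trans (n * r)%N); first by rewrite leq_mul2r mn orbT.
apply: leq_trans (@nonparallel_packing d n G r _ _) _.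
- move=> i; apply: contra (g0 i) => /eqP/rowP Gi0; apply/eqP/rowP => j.
  by rewrite -GE Gi0 !mxE.
- move=> i j /gfree/free2_minorP[x [y xy]]; exists x, y.
  by rewrite minorE.
rewrite leq_add2r /norm1 exchange_big/= -[d in leqRHS]card_ord -sum_nat_const.
apply: leq_sum => j _; rewrite -(ler_nat R) natr_sum.
(* The sign vectors [e] and [f] maximize and minimize the [j]-th coordinate; the difference, the sum
   of the [|g i j|], is at most [k]. *)
pose e i := 0 < g i ord0 j; pose f i := g i ord0 j < 0.
have Ze : Z (boolpt a g e).
  by rewrite ZE; exists (fun i => (e i)%:R) => //; exact: unit_cube_bool.
have Zf : Z (boolpt a g f).
  by rewrite ZE; exists (fun i => (f i)%:R) => //; exact: unit_cube_bool.
have /andP[_ ek] := Zk _ Ze j; have /andP[f0 _] := Zk _ Zf j.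
have -> : \sum_i (`|G i ord0 j|%N)%:R = boolpt a g e ord0 j - boolpt a g f ord0 j.
  transitivity ((boolpt a g e - boolpt a g f) ord0 j); last by rewrite !mxE.
  rewrite zpointB summxE; apply: eq_bigr => i _.
  rewrite natr_absz intr_norm GE [RHS]mxE /e /f.
  by case: ltrgt0P => /= _; ring.
by lra.
Qed.

Lemma diameters_lower (R : realType) (d k r : nat) :
  (\sum_(v <- half_prim_ball d r) norm1 v <= d * k)%N -> (0 < d)%N ->
  zonotope_diameters R d k (size (half_prim_ball d r)).
Proof.
move=> Sk d0; set s := half_prim_ball d r; set n := size s.
pose w (i : 'I_n) := nth 0 s i.
have ws i : w i \in s by rewrite mem_nth.
have w_inj i j : w i = w j -> i = j.
  move=> /eqP; rewrite nth_uniq ?uniq_half_prim_ball// => /eqP; exact: val_inj.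
pose g i : 'rV[R]_d := map_mx intr (w i).
(* Starting from the negative parts, the [i]-th segment has its [j]-th coordinate between 0 and the
   absolute value of that of [w i]. *)
pose a i : 'rV[R]_d := \row_j (if w i ord0 j < 0 then - w i ord0 j else 0)%:~R.
pose b i : 'rV[R]_d := a i + g i.
have gE i : b i - a i = g i by rewrite addrC addKr.
have gfree i j : i != j -> free [:: g i; g j].
  move=> ij; apply/free2_minorP; apply: contrapT => no.
  have := ws i; have := ws j; rewrite !mem_half_prim_ball.
  move=> /and3P[/eqP j1 _ jN] /and3P[/eqP i1 _ iN].
  have [x y|/w_inj/eqP|wN] := primitive_parallel i1 j1.
  - apply/eqP/negPn/negP => H; apply: no; exists x, y; rewrite !mxE -!intrM eqr_int.
    by [].
  - by rewrite (negPf ij).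
  - by move: iN; rewrite wN opprK ltnNge ltnW.
have g0 i : g i != 0.
  apply/eqP => /rowP gi0; have := ws i; rewrite mem_half_prim_ball => /and3P[+ _ _].
  suff -> : w i = 0 by rewrite vcontent0.
  by apply/rowP => j; have := gi0 j; rewrite !mxE => /eqP; rewrite intr_eq0 => /eqP.
exists (zonotope a g).
have ZE : zonotope a g = minkowski_sum (fun i => segment (a i) (b i)).
  by rewrite minkowski_zonotope; congr zonotope; apply/funext => i; rewrite gE.
have inta i j : a i ord0 j \is a Num.int by rewrite mxE intr_int.
have intg i j : g i ord0 j \is a Num.int by rewrite mxE intr_int.
split; last exact: zonotope_diameter.
- split; last first.
    split; first exact: zonotope_polytope.
    move=> v /(vertexP g0)[c _ ->] j; rewrite summxE rpred_sum// => i _.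
    have -> : (a i + (sgnvec g c i)%:R *: g i) ord0 j = a i ord0 j + (sgnvec g c i)%:R * g i ord0 j.
      by rewrite !mxE.
    by rewrite rpredD// rpredM// natr_int.
  exists n, a, b; split=> // [i ab|i j /eqP ij].
    by have := g0 i; rewrite -gE ab subrr eqxx.
  by rewrite !gE gfree.
- move=> _ [t ct <-] j; rewrite summxE.
  have bnd i : 0 <= (a i + t i *: g i) ord0 j <= (`|w i ord0 j|%N)%:R.
    rewrite !mxE natr_absz; have /andP[t0 t1] := ct i.
    case: ltrP => wij; rewrite ?(ltr0_norm wij) ?(ger0_norm wij).
      have w0 : (w i ord0 j)%:~R < 0 :> R by rewrite ltrz0.
      rewrite intrN; apply/andP; split; nra.
    have w0 : 0 <= (w i ord0 j)%:~R :> R by rewrite ler0z.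
    by rewrite add0r; apply/andP; split; nra.
  apply/andP; split; first by apply: sumr_ge0 => i _; have /andP[] := bnd i.
  apply: (@le_trans _ _ (\sum_(i < n) (`|w i ord0 j|%N)%:R)).
    by apply: ler_sum => i _; have /andP[] := bnd i.
  rewrite -natr_sum ler_nat -(leq_pmul2l d0) (leq_trans _ Sk)//.
  (* Each coordinate receives exactly the fraction [1 / d] of the sum of norms. *)
  rewrite -(sum_half_prim_coord r j) leq_mul2l; apply/orP; right.
  by rewrite -/s (big_nth 0) big_mkord.
Qed.

(** * Asymptotics *)

Section Zeta.
Variables (R : realType) (d : nat).
Hypothesis d_ge2 : (2 <= d)%N.

Definition zeta_partial (M : nat) : R := \sum_(m < M) (m.+1%:R ^+ d)^-1.

Lemma zeta_partial_ler M N : (M <= N)%N -> zeta_partial M <= zeta_partial N.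
Proof.
elim: N => [|N IH]; first by rewrite leqn0 => /eqP ->.
rewrite leq_eqVlt => /orP[/eqP -> //|]; rewrite ltnS => /IH /le_trans -> //.
by rewrite /zeta_partial big_ord_recr/= lerDl invr_ge0 exprn_ge0.
Qed.

(** Compare with the telescoping [1 / (y (y + 1))], starting from [1 + 1 / 4 = 7 / 4 - 1 / 2]. What
    matters is a bound below 2: the terms after the first sum to at most [3 / 4], the later
    contraction factor. *)
Lemma zeta_partial_le M : zeta_partial M <= 7 / 4.
Proof.
have H (n : nat) : zeta_partial n.+2 <= 7 / 4 - n.+2%:R^-1.
  elim: n => [|n IH].
    rewrite /zeta_partial !big_ord_recr big_ord0/= expr1n invr1 add0r.
    have : ((2 : R) ^+ d)^-1 <= (2 ^+ 2)^-1.
      by rewrite lef_pV2 ?posrE ?exprn_gt0// ler_eXn2l// ltr1n.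
    lra.
  rewrite /zeta_partial big_ord_recr/= -/(zeta_partial n.+2).
  have y0 : (0 : R) < n.+2%:R by rewrite ltr0n.
  have y1 : (1 : R) < n.+2%:R by rewrite ltr1n.
  have -> : n.+3%:R = n.+2%:R + 1 :> R by rewrite -natr1.
  move: (n.+2%:R : R) (zeta_partial n.+2) y0 y1 IH => y z y0 y1 IH.
  have z0 : 0 < y + 1 by rewrite addr_gt0.
  have dn : ((y + 1) ^+ d)^-1 <= ((y + 1) ^+ 2)^-1.
    rewrite lef_pV2 ?posrE ?exprn_gt0//.
    by rewrite ler_weXn2l// lerDr ltW.
  have : ((y + 1) ^+ 2)^-1 <= y^-1 - (y + 1)^-1.
    have -> : y^-1 - (y + 1)^-1 = (y * (y + 1))^-1.
      by field; rewrite !lt0r_neq0.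
    by rewrite lef_pV2 ?posrE ?exprn_gt0 ?mulr_gt0// expr2 ler_wpM2r ?ltW// ltrDl.
  by lra.
apply: le_trans (zeta_partial_ler (leq_addr 2 M)) _; rewrite addn2.
by apply: le_trans (H M) _; rewrite gerBl invr_ge0.
Qed.

Lemma zeta_partial_cvg : zeta_partial M @[M --> \oo] --> zeta R d.
Proof.
have -> : zeta_partial = series (fun n : nat => (n.+1%:R ^+ d)^-1 : R).
  by apply/funext => M; rewrite /zeta_partial seriesEord.
apply: nondecreasing_is_cvgn => [m n mn|].
  by have := zeta_partial_ler mn; rewrite /zeta_partial !seriesEord.
exists (7 / 4) => _ [n _ <-]; have := zeta_partial_le n.
by rewrite /zeta_partial seriesEord.
Qed.

Lemma zeta_ge_partial M : zeta_partial M <= zeta R d.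
Proof.
rewrite -(cvg_lim _ zeta_partial_cvg)//.
apply: nondecreasing_cvgn_le; first by move=> m n; exact: zeta_partial_ler.
by apply/cvg_ex; exists (zeta R d); exact: zeta_partial_cvg.
Qed.

Lemma zeta_partial_near (e : R) : 0 < e ->
  exists M : nat, (0 < M)%N /\ zeta R d - zeta_partial M <= e.
Proof.
move=> e0; have /cvgrPdist_le/(_ e e0)[N _ HN] := zeta_partial_cvg.
exists N.+1; split=> //; apply: le_trans (HN N.+1 (leqnSn N)).
exact: ler_norm.
Qed.

Lemma zeta_ge1 : 1 <= zeta R d.
Proof.
apply: le_trans (zeta_ge_partial 1).
by rewrite /zeta_partial big_ord1 expr1n invr1.
Qed.

End Zeta.

(** * Asymptotics of the form [A x^d] *)

Section PowerAsymptotics.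
Variable R : realType.
Implicit Types (f g : R -> R) (A B x y z e : R) (d n : nat).

(* [f x ~ A x ^ d] as [x] tends to infinity, also meaningful for [A = 0]. *)
Definition asymp_pow f A d : Prop := forall e, 0 < e ->
  exists X, forall x, X <= x -> `|f x - A * x ^+ d| <= e * x ^+ d.

(** Bernoulli's inequality in homogeneous form, which avoids dividing by [y] and allows negative
    [z]. *)
Lemma bernoulli n y z : 0 <= y -> 0 <= y + z ->
  y ^+ n.+1 + n.+1%:R * z * y ^+ n <= (y + z) ^+ n.+1.
Proof.
move=> y0 yz; elim: n => [|n IH]; first by rewrite expr0 !expr1 mulr1 mul1r.
rewrite [leRHS]exprS; apply: le_trans (ler_wpM2l yz IH).
have -> : (y + z) * (y ^+ n.+1 + n.+1%:R * z * y ^+ n) =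
    y ^+ n.+2 + n.+2%:R * z * y ^+ n.+1 + n.+1%:R * z ^+ 2 * y ^+ n.
  by rewrite -[n.+2%:R]natr1 !exprS; ring.
by rewrite lerDl mulr_ge0 ?exprn_ge0// mulr_ge0 ?sqr_ge0.
Qed.

Lemma asymp_pow_shift d (c : R) : 0 <= c -> (0 < d)%N -> forall e, 0 < e ->
  exists2 X, c <= X & forall x, X <= x ->
    (x + c) ^+ d <= (1 + e) * x ^+ d /\ (1 - e) * x ^+ d <= (x - c) ^+ d.
Proof.
move=> c0; case: d => // d _ e e0.
(* Bernoulli bounds both changes by [d.+1 * c * (x + c)^d], and [x + c <= 2 x] once [c <= x]. *)
pose B := d.+1%:R * c * 2 ^+ d.
have B0 : 0 <= B by rewrite !mulr_ge0 ?exprn_ge0.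
exists (c + B / e) => [|x Xx]; first by rewrite lerDl divr_ge0// ltW.
have cx : c <= x by apply: le_trans Xx; rewrite lerDl divr_ge0// ltW.
have x0 : 0 <= x by exact: le_trans cx.
have Bx : B * x ^+ d <= e * x ^+ d.+1.
  rewrite exprS mulrA ler_wpM2r ?exprn_ge0// mulrC -ler_pdivrMr//.
  by apply: le_trans Xx; rewrite lerDr.
have d2 : d.+1%:R * c <= B by rewrite ler_peMr ?mulr_ge0// exprn_ege1// ler1n.
split.
  have := @bernoulli d (x + c) (- c) (addr_ge0 x0 c0).
  rewrite addrK => /(_ x0); rewrite mulrN mulNr.
  have : d.+1%:R * c * (x + c) ^+ d <= B * x ^+ d.
    rewrite -[leRHS]mulrA -exprMn ler_wpM2l ?mulr_ge0// lerXn2r ?nnegrE ?addr_ge0 ?mulr_ge0//.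
    lra.
  lra.
have xc : 0 <= x + - c by rewrite subr_ge0.
have := @bernoulli d x (- c) x0 xc; rewrite mulrN mulNr.
have : d.+1%:R * c * x ^+ d <= B * x ^+ d by rewrite ler_wpM2r ?exprn_ge0.
lra.
Qed.

Lemma asymp_pow_sandwich f A d c : 0 <= A -> 0 <= c -> (0 < d)%N ->
  (exists X, forall x, X <= x -> A * (x - c) ^+ d <= f x <= A * (x + c) ^+ d) ->
  asymp_pow f A d.
Proof.
move=> A0 c0 d0 [X HX] e e0.
have A1 : 0 < A + 1 by rewrite ltr_wpDl.
have [Y cY HY] := asymp_pow_shift c0 d0 (divr_gt0 e0 A1).
exists (Num.max X Y) => x; rewrite ge_max => /andP[/HX/andP[f1 f2] Yx].
have [H1 H2] := HY x Yx.
have x0 : 0 <= x ^+ d by rewrite exprn_ge0// (le_trans c0)// (le_trans cY).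
have eA : A * (e / (A + 1)) <= e.
  by rewrite mulrA ler_pdivrMr// mulrC (ler_wpM2l (ltW e0))// lerDl.
have G1 := ler_wpM2l A0 H1; have G2 := ler_wpM2l A0 H2.
have G3 := ler_wpM2r x0 eA.
rewrite ler_norml; apply/andP; split; nra.
Qed.

End PowerAsymptotics.

Lemma ffact_le_exp (n d : nat) : (n ^_ d <= n ^ d)%N.
Proof.
elim: d n => [|d IH] [|n]//.
rewrite ffactSS expnS leq_mul2l /= (leq_trans (IH n))//.
by case: d {IH} => // d; rewrite leq_exp2r.
Qed.

Lemma exp_le_ffact (n d : nat) : ((n - d) ^ d <= n ^_ d)%N.
Proof.
elim: d n => [|d IH] [|n]//; first by rewrite sub0n exp0n.
by rewrite ffactSS expnS subSS leq_mul// (leq_trans (leq_subr _ _)).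
Qed.

(** This matches the integer radii [r %/ m.+1] with the real arguments [x / m.+1]. *)
Lemma truncn_divn (R : realType) (x : R) (m : nat) : 0 <= x ->
  Num.trunc (x / m.+1%:R) = (Num.trunc x %/ m.+1)%N.
Proof.
move=> x0; have m0 : (0 : R) < m.+1%:R by [].
have xm : 0 <= x / m.+1%:R by rewrite divr_ge0.
apply/eqP; rewrite eqn_leq leq_divRL// truncn_ge_nat// truncn_ge_nat//.
rewrite natrM -ler_pdivlMr// truncn_le xm/= ler_pdivlMr// -natrM.
by rewrite -truncn_ge_nat// leq_trunc_div.
Qed.

(** * Counting primitive vectors *)

Section PrimitiveAsymptotics.
Variables (R : realType) (d : nat).
Hypothesis d_ge2 : (2 <= d)%N.

(** [V] is the volume of the unit cross-polytope, [W] the expected density of primitive vectors, [C]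
    the constant of a crude bound. *)
Let V : R := 2 ^+ d / d`!%:R.
Let W : R := V / zeta R d.
Let C : R := (2 * d.+1%:R) ^+ d.
Let P (x : R) : R := (size (prim_ball d (Num.trunc x)))%:R.

Let V_ge0 : 0 <= V. Proof. by rewrite divr_ge0 ?exprn_ge0. Qed.
Let zeta_gt0 : 0 < zeta R d.
Proof. exact: lt_le_trans (zeta_ge1 R d_ge2). Qed.
Let W_ge0 : 0 <= W. Proof. by rewrite divr_ge0// ltW. Qed.
Let C_ge0 : 0 <= C. Proof. by rewrite exprn_ge0// mulr_ge0. Qed.

Lemma ball1_asymp : asymp_pow (fun x : R => (size (ball1 d (Num.trunc x)))%:R) V d.
Proof.
have f0 : (0 : R) < d`!%:R by rewrite ltr0n fact_gt0.
apply: (@asymp_pow_sandwich _ _ _ _ d.+1%:R) => //; first exact: ltnW.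
exists d.+1%:R => x dx.
have x0 : 0 <= x by exact: le_trans dx.
have /andP[nx xn] := truncn_itv x0; set n := Num.trunc x in nx xn *.
have bE (m : nat) : ('C(m, d))%:R = (m ^_ d)%:R / d`!%:R :> R.
  by rewrite -bin_ffact natrM mulfK// lt0r_neq0.
have VE z : 2 ^+ d * (z / d`!%:R) = V * z by rewrite /V; ring.
apply/andP; split.
  have := size_ball1_ge d n; rewrite -(ler_nat R) natrM natrX bE; apply: le_trans.
  rewrite VE ler_wpM2l//.
  have dn : (d <= n)%N.
    by apply: ltnW; rewrite -ltnS -(ltr_nat R); exact: le_lt_trans dx xn.
  apply: (@le_trans _ _ ((n - d) ^ d)%:R); last by rewrite ler_nat exp_le_ffact.
  rewrite natrX lerXn2r ?nnegrE ?subr_ge0// natrB//.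
  by move: xn; rewrite -!natr1; lra.
have := size_ball1_le d n; rewrite -(ler_nat R) natrM natrX bE => /le_trans; apply.
rewrite VE ler_wpM2l//.
apply: (@le_trans _ _ ((n + d) ^ d)%:R); first by rewrite ler_nat ffact_le_exp.
rewrite natrX lerXn2r ?nnegrE ?addr_ge0//.
by rewrite natrD -natr1; lra.
Qed.

Lemma prim_ball0 (k : nat) : prim_ball k 0 = [::].
Proof.
apply/eqP; rewrite -[_ == _]negbK -has_filter; apply/hasPn => v.
by rewrite mem_ball1 leqn0 norm1_eq0 => /eqP ->; rewrite vcontent0.
Qed.

(** Crude, but valid without a threshold, as the tail of the sum over [m] requires. *)
Lemma prim_le (x : R) : 0 <= x -> P x <= C * x ^+ d.
Proof.
move=> x0; rewrite /P; have /andP[nx _] := truncn_itv x0.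
set n := Num.trunc x in nx *; have [->|n0] := posnP n.
  by rewrite prim_ball0 mulr_ge0// exprn_ge0.
apply: (@le_trans _ _ ((2 * d.+1) ^ d * n ^ d)%:R); last first.
  rewrite natrM !natrX natrM ler_wpM2l//.
  by rewrite lerXn2r ?nnegrE.
rewrite ler_nat -expnMn (leq_trans (size_subseq (filter_subseq _ _)))//.
apply: leq_trans (size_ball1_le d n) _.
rewrite -mulnA expnMn leq_mul2l; apply/orP; right.
apply: leq_trans (@leq_pmulr _ d`! (fact_gt0 d)) _; rewrite bin_ffact.
apply: leq_trans (ffact_le_exp _ _) _; rewrite leq_exp2r; last exact: ltnW.
by rewrite mulSn leq_add2l leq_pmulr.
Qed.

Let E (x : R) : R := P x - W * x ^+ d.

(* The error term satisfies [\sum_m E (x / m) = o (x ^ d)], and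
   [\sum_(m >= 2) m ^ -d < 1], so that any bound on it can be improved. *)
Lemma prim_error_step (K e : R) : 0 <= K -> 0 < e ->
  (exists X, forall x, X <= x -> `|E x| <= K * x ^+ d) ->
  exists X, forall x, X <= x -> `|E x| <= (3 / 4 * K + e) * x ^+ d.
Proof.
move=> K0 e0 [X HX].
have e4 : 0 < e / 4 by rewrite divr_gt0.
have CW : 0 < C + W + 1 by rewrite ltr_wpDl// addr_ge0.
(* The tail of [zeta] beyond [M.+1] is to cost at most [e / 4], counting both the primitive vectors
   (through [C]) and the main term (through [W]). *)
have [[|M] [// _ HM]] := zeta_partial_near d_ge2 (divr_gt0 e4 CW).
have [Y HY] := ball1_asymp e4.
have M0 : (0 : R) < M.+1%:R by [].
(* Beyond this threshold [x / m >= X] for all [m <= M.+1], and [1 <= e / 4 * x ^+ d], which absorbs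
   the zero vector. *)
exists (Num.max (Num.max Y (`|X| * M.+1%:R)) (Num.max M.+1%:R (1 + 4 / e))) => x.
rewrite !ge_max => /andP[/andP[Yx Xx] /andP[Mx ex]].
have x0 : 0 <= x by exact: le_trans Mx.
have x1 : 1 <= x by apply: le_trans ex; rewrite lerDl divr_ge0// ltW.
set y := x ^+ d; have y0 : 0 <= y by rewrite exprn_ge0.
have y1 : 1 <= e / 4 * y.
  apply: (@le_trans _ _ (e / 4 * x)).
    rewrite -ler_pdivrMl// mulr1 invf_div; apply: le_trans ex.
    by rewrite lerDr.
  rewrite ler_wpM2l ?(ltW e4)// -[leLHS]expr1 ler_weXn2l//; exact: ltnW.
set N := Num.trunc x; have MN : (M.+1 <= N)%N by rewrite truncn_ge_nat.
have powE m : (x / m.+1%:R) ^+ d = y * (m.+1%:R ^+ d)^-1 by rewrite exprMn exprVn.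
have xm m : 0 <= x / m.+1%:R by rewrite divr_ge0.
have LE : (size (ball1 d N))%:R = 1 + \sum_(m < M.+1) P (x / m.+1%:R)
     + \sum_(M.+1 <= m < N) P (x / m.+1%:R).
  rewrite size_ball1_prim natrD natr_sum -addrA; congr (_ + _).
  rewrite -(big_mkord xpredT (fun m => P (x / m.+1%:R))) -big_cat_nat//=.
  by rewrite big_mkord; apply: eq_bigr => m _; rewrite /P truncn_divn.
set T := \sum_(M.+1 <= m < N) _ in LE.
have T0 : 0 <= T by rewrite sumr_ge0.
have TC : T <= C * y * (zeta R d - zeta_partial R d M.+1).
  apply: (@le_trans _ _ (C * y * (zeta_partial R d N - zeta_partial R d M.+1))); last first.
    by rewrite ler_wpM2l ?mulr_ge0// lerD2r zeta_ge_partial.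
  have -> : zeta_partial R d N - zeta_partial R d M.+1 = \sum_(M.+1 <= m < N) (m.+1%:R ^+ d)^-1.
    rewrite /zeta_partial -!(big_mkord xpredT (fun m => (m.+1%:R ^+ d)^-1)).
    by rewrite (@big_cat_nat _ _ _ M.+1 0 N)//= addrAC subrr add0r.
  rewrite mulr_sumr; apply: ler_sum => m _; rewrite -mulrA -powE; exact: prim_le.
have ME : \sum_(m < M.+1) E (x / m.+1%:R) =
    \sum_(m < M.+1) P (x / m.+1%:R) - W * y * zeta_partial R d M.+1.
  rewrite sumrB mulr_sumr; congr (_ - _); apply: eq_bigr => m _.
  by rewrite powE mulrA.
have E0 : \sum_(m < M.+1) E (x / m.+1%:R) = E x + \sum_(m < M) E (x / m.+2%:R).
  by rewrite big_ord_recl/= divr1.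
(* The scales [m = 2, ..., M.+1] carry factors [m^-d], of sum at most [7 / 4 - 1]. *)
have S3 : `|\sum_(m < M) E (x / m.+2%:R)| <= 3 / 4 * K * y.
  apply: le_trans (ler_norm_sum _ _ _) _.
  apply: (@le_trans _ _ (\sum_(m < M) K * y * (m.+2%:R ^+ d)^-1)).
    apply: ler_sum => m _; rewrite -mulrA -powE; apply: HX.
    apply: le_trans (ler_norm X) _; rewrite ler_pdivlMr//.
    by apply: le_trans Xx; rewrite ler_wpM2l// ler_nat ltnS.
  rewrite -mulr_sumr; have := zeta_partial_le R d_ge2 M.+1.
  rewrite /zeta_partial big_ord_recl/= expr1n invr1 => zM.
  rewrite (_ : 3 / 4 * K * y = K * y * (3 / 4)); last by ring.
  rewrite ler_wpM2l ?mulr_ge0//.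
  by move: zM; rewrite /bump/=; under eq_bigr do rewrite add1n; lra.
have LV := HY x Yx; rewrite -/N -/y in LV.
have VW : V = W * zeta R d by rewrite /W divfK// lt0r_neq0.
have HM' : (C + W) * (zeta R d - zeta_partial R d M.+1) * y <= e / 4 * y.
  rewrite ler_wpM2r//; have := ler_wpM2l (ltW CW) HM.
  rewrite [_ * (e / 4 / _)]mulrC divfK ?lt0r_neq0//; apply: le_trans.
  rewrite ler_wpM2r ?lerDl// subr_ge0; exact: zeta_ge_partial.
have W0 : 0 <= W * y * (zeta R d - zeta_partial R d M.+1).
  by apply: mulr_ge0; [exact: mulr_ge0|rewrite subr_ge0 zeta_ge_partial].
move: LV S3; rewrite VW !ler_norml => /andP[L1 L2] /andP[S1 S2].
set Z := zeta_partial R d M.+1 in ME TC HM' W0 *.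
set S := \sum_(m < M) E _ in E0 S1 S2.
set z := zeta R d in TC HM' L1 L2 W0.
have EE : E x = (size (ball1 d N))%:R - W * z * y - 1 - T + W * y * (z - Z) - S.
  by rewrite LE; move: ME; rewrite E0; set A := \sum_(m < _) P _ => ME; rewrite -[E x](addrK S) ME; ring.
rewrite EE; apply/andP; split; nra.
Qed.

Lemma prim_asymp : asymp_pow P W d.
Proof.
have E1 : exists X, forall x, X <= x -> `|E x| <= (C + W) * x ^+ d.
  exists 0 => x x0; have := prim_le x0.
  have : 0 <= P x by []. have : 0 <= x ^+ d by rewrite exprn_ge0.
  rewrite /E; move: (x ^+ d) (P x) => y p y0 p0 pC; rewrite ler_norml.
  have := mulr_ge0 C_ge0 y0; have := mulr_ge0 W_ge0 y0.
  by move=> ? ?; apply/andP; split; lra.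
move=> e e0; have e2 : 0 < e / 2 by rewrite divr_gt0.
have q0 (n : nat) : 0 <= (3 / 4 : R) ^+ n by rewrite exprn_ge0// divr_ge0.
have H n : exists X, forall x, X <= x -> `|E x| <= ((C + W) * (3 / 4) ^+ n + e / 2) * x ^+ d.
  elim: n => [|n IH].
    case: E1 => X HX; exists (Num.max X 0) => x; rewrite ge_max => /andP[/HX Ex x0].
    apply: le_trans Ex _; rewrite ler_wpM2r ?exprn_ge0// expr0 mulr1.
    by rewrite lerDl ltW.
  (* The additive error is stable: [3 / 4 * (e / 2) + e / 8 = e / 2]. *)
  have e8 : 0 < e / 8 by rewrite divr_gt0.
  have K0 : 0 <= (C + W) * (3 / 4) ^+ n + e / 2.
    by rewrite addr_ge0 ?(ltW e2)// mulr_ge0 ?addr_ge0.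
  have [X HX] := prim_error_step K0 e8 IH.
  exists X => x /HX; congr (_ <= _ * _); rewrite exprS; lra.
have [n Hn] : exists n, (C + W) * (3 / 4) ^+ n <= e / 2.
  have : (C + W) * (3 / 4) ^+ n @[n --> \oo] --> (C + W) * 0.
    apply: cvgMr; apply: cvg_expr; rewrite ger0_norm; lra.
  rewrite mulr0 => /cvgrPdist_le/(_ _ e2)[n _ /(_ n (leqnn n))]/=.
  by rewrite sub0r normrN ger0_norm => [?|]; [exists n|rewrite mulr_ge0 ?addr_ge0].
have [X HX] := H n; exists (Num.max X 0) => x; rewrite ge_max => /andP[/HX Ex x0].
by apply: le_trans Ex _; rewrite ler_wpM2r ?exprn_ge0//; lra.
Qed.

End PrimitiveAsymptotics.

(** * Summation of asymptotics *)

Section SumAsymptotics.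
Variable R : realType.

(** Bernoulli with [z = 1] bounds each term by a difference of consecutive powers; [z = -1] gives
    the opposite bound in [sum_pow_ge]. *)
Lemma sum_pow_le (d n : nat) :
  d.+1%:R * (\sum_(s < n) s%:R ^+ d) <= (n%:R : R) ^+ d.+1.
Proof.
elim: n => [|n IH]; first by rewrite big_ord0 mulr0 exprn_ge0.
rewrite big_ord_recr/= mulrDr -[in leRHS]natr1.
apply: le_trans (@bernoulli R d n%:R 1 (ler0n R n) (addr_ge0 (ler0n R n) ler01)).
by rewrite mulr1 lerD2r.
Qed.

Lemma sum_pow_ge (d n : nat) :
  (n%:R : R) ^+ d.+1 <= d.+1%:R * (\sum_(s < n.+1) s%:R ^+ d).
Proof.
elim: n => [|n IH]; first by rewrite expr0n mulr_ge0// sumr_ge0// => s _; rewrite exprn_ge0.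
rewrite big_ord_recr/= mulrDr.
have := @bernoulli R d n.+1%:R (-1) (ler0n R _); rewrite -natr1 addrK => /(_ (ler0n R _)).
rewrite mulrN1 mulNr => H; move: IH H; lra.
Qed.

Lemma asymp_sum_pow (d : nat) :
  asymp_pow (fun x : R => \sum_(s < Num.trunc x) s%:R ^+ d) d.+1%:R^-1 d.+1.
Proof.
apply: (@asymp_pow_sandwich _ _ _ _ 2) => //.
exists 2 => x x2; have x0 : 0 <= x by apply: le_trans x2.
have /andP[nx xn] := truncn_itv x0; set n := Num.trunc x in nx xn *.
have d0 : (0 : R) < d.+1%:R by [].
apply/andP; split.
  rewrite ler_pdivrMl//; case: n nx xn => [|n] nx xn; first by move: xn; lra.
  apply: le_trans (sum_pow_ge d n); rewrite lerXn2r ?nnegrE ?subr_ge0//.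
  by move: xn; rewrite -!natr1; lra.
rewrite ler_pdivlMl//; apply: le_trans (sum_pow_le d n) _.
by rewrite lerXn2r ?nnegrE ?addr_ge0//; lra.
Qed.

(** The early terms contribute a constant [B], negligible against [x ^+ d.+1]; the later errors are
    at most [e / 3] times a sum of powers. *)
Lemma asymp_sum (f : nat -> R) (A : R) (d : nat) :
  asymp_pow (fun x => f (Num.trunc x)) A d ->
  asymp_pow (fun x => \sum_(s < Num.trunc x) f s) (A / d.+1%:R) d.+1.
Proof.
move=> fA e e0; have e3 : 0 < e / 3 by rewrite divr_gt0.
have [X HX] := fA _ e3.
pose n0 := (Num.trunc `|X|).+1; pose D s := f s - A * s%:R ^+ d.
have Dle s : (n0 <= s)%N -> `|D s| <= e / 3 * s%:R ^+ d.
  move=> ns; have := HX s%:R; rewrite natrK; apply.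
  apply: le_trans (ler_norm X) _; apply: ltW.
  by apply: lt_le_trans (truncnS_gt _) _; rewrite ler_nat.
pose B := \sum_(s < n0) `|D s|.
have B0 : 0 <= B by rewrite sumr_ge0.
have DB n : \sum_(s < n) `|D s| <= B + e / 3 * \sum_(s < n) s%:R ^+ d.
  have S0 m : 0 <= e / 3 * \sum_(s < m) s%:R ^+ d.
    by rewrite mulr_ge0 ?(ltW e3)// sumr_ge0// => s _; rewrite exprn_ge0.
  elim: n => [|n IH]; first by rewrite !big_ord0 mulr0 addr0.
  have [nn0|n0n] := leqP n.+1 n0.
    apply: (@le_trans _ _ B); last by rewrite lerDl.
    rewrite /B -!(big_mkord xpredT (fun s => `|D s|)) (@big_cat_nat _ _ _ n.+1 0 n0)//=.
    by rewrite lerDl sumr_ge0.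
  by rewrite !big_ord_recr/= mulrDr addrA lerD// Dle.
have A1 : 0 < `|A| + 1 by rewrite ltr_wpDl.
have [Y HY] := asymp_sum_pow d (divr_gt0 e3 A1).
exists (Num.max Y (Num.max 1 (B / (e / 3)))) => x; rewrite !ge_max => /and3P[/HY Yx x1 Bx].
have x0 : 0 <= x by exact: le_trans x1.
have /andP[nx _] := truncn_itv x0; set n := Num.trunc x in nx Yx *.
set Q := \sum_(s < n) s%:R ^+ d in Yx.
set y := x ^+ d.+1 in Yx *; have y0 : 0 <= y by rewrite exprn_ge0.
have By : B <= e / 3 * y.
  rewrite -ler_pdivrMl// mulrC; apply: le_trans Bx _.
  by rewrite -[leLHS]expr1 ler_weXn2l.
have Qy : Q <= y.
  apply: (@le_trans _ _ (d.+1%:R * Q)).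
    by rewrite ler_peMl ?ler1n// sumr_ge0// => s _; rewrite exprn_ge0.
  by apply: le_trans (sum_pow_le d n) _; rewrite lerXn2r ?nnegrE.
have -> : \sum_(s < n) f s - A / d.+1%:R * y =
    \sum_(s < n) D s + A * (Q - d.+1%:R^-1 * y).
  by rewrite sumrB -mulr_sumr -/Q; ring.
apply: le_trans (ler_normD _ _) _; rewrite normrM.
have H1 := le_trans (ler_norm_sum _ _ _) (DB n).
have H2 : `|A| * `|Q - d.+1%:R^-1 * y| <= e / 3 * y.
  apply: le_trans (ler_wpM2l (normr_ge0 A) Yx) _; rewrite mulrA ler_wpM2r//.
  by rewrite mulrA ler_pdivrMr// mulrC (ler_wpM2l (ltW e3))// lerDl.
have H3 : e / 3 * Q <= e / 3 * y by rewrite (ler_wpM2l (ltW e3)).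
rewrite -/Q in H1; move: H1 H2 H3 By; lra.
Qed.

End SumAsymptotics.

(** * Upper and lower bounds for the largest diameter *)

Section DeltaAsymptotics.
Variables (R : realType) (d : nat).
Hypothesis d_ge2 : (2 <= d)%N.

Definition half_density : R := 2 ^+ d / d`!%:R / zeta R d / 2.

Let A := half_density.

Lemma half_density_gt0 : 0 < A.
Proof.
by rewrite !divr_gt0 ?exprn_gt0 ?ltr0n ?fact_gt0// (lt_le_trans _ (zeta_ge1 R d_ge2)).
Qed.

Let A_gt0 := half_density_gt0.

Lemma half_prim_asymp :
  asymp_pow (fun x : R => (size (half_prim_ball d (Num.trunc x)))%:R) A d.
Proof.
move=> e e0; have e2 : 0 < 2 * e by rewrite mulr_gt0.
have [X HX] := prim_asymp d_ge2 e2; exists X => x /HX.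
rewrite size_prim_ball natrM.
have -> : 2 ^+ d / d`!%:R / zeta R d = 2 * A by rewrite /A /half_density mulrCA divff ?mulr1.
by rewrite -!mulrA -mulrBr normrM ger0_norm// ler_pM2l.
Qed.

Lemma asymp_half_prim_sum :
  asymp_pow (fun x : R => \sum_(s < Num.trunc x) (size (half_prim_ball d s))%:R)
    (A / d.+1%:R) d.+1.
Proof.
exact: (@asymp_sum _ (fun n => (size (half_prim_ball d n))%:R) _ _ half_prim_asymp).
Qed.

(** The default in [delta_z] is never taken: radius 0, with no generators, shows that the set is
    nonempty, and [r = 1] in [diameters_upper] that it is bounded. *)
Lemma delta_zP (k : nat) : zonotope_diameters R d k (delta_z R d k) /\
  ubound (zonotope_diameters R d k) (delta_z R d k).
Proof.
apply: (@xgetPex _ 0%N (zonotope_diameters R d k `&` ubound (zonotope_diameters R d k))).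
pose p n := `[< zonotope_diameters R d k n >].
have d0 : (0 < d)%N by exact: ltnW.
have p_ex : exists n, p n.
  exists (size (half_prim_ball d 0)); apply/asboolP/diameters_lower => //.
  by rewrite /half_prim_ball prim_ball0 big_nil.
have p_ub n : p n -> (n <= d * k + \sum_(s < 1) size (half_prim_ball d s))%N.
  by move=> /asboolP/(diameters_upper 1); rewrite muln1.
case: (ex_maxnP p_ex p_ub) => n /asboolP pn n_max.
by exists n; split=> // m /asboolP; exact: n_max.
Qed.

(** The relation between [x] and [k] says that [d k] is the leading term of the sum of norms at
    radius [x]. With [r] the truncation of [x], the packing bound becomes
    [D r <= (A + e / 2) x^(d+1)]. *)
Lemma delta_upper (e : R) : 0 < e -> exists X, forall x (k : nat), X <= x ->
  d.+1%:R * k%:R = A * x ^+ d.+1 -> (delta_z R d k)%:R <= (A + e) * x ^+ d.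
Proof.
move=> e0; have e2 : 0 < e / 2 by rewrite divr_gt0.
have [X HX] := asymp_half_prim_sum e2.
(* This gives [(A + e / 2) x <= (A + e) (x - 1)], which pays for truncating [x]. *)
exists (Num.max X (2 + (A + e) / (e / 2))) => x k; rewrite ge_max => /andP[/HX Hx ex] kE.
have [/(diameters_upper (Num.trunc x)) + _] := delta_zP k.
have Ae : 0 <= (A + e) / (e / 2) by rewrite divr_ge0 ?addr_ge0 ?(ltW e2)// ltW.
have x2 : 2 <= x by move: ex; lra.
have {}ex : A + e <= x * (e / 2).
  by rewrite -ler_pdivrMr//; move: ex; set w := _ / _; lra.
have x0 : 0 <= x by lra.
have /andP[_] := truncn_itv x0; rewrite -natr1.
rewrite -(ler_nat R) natrM natrD natrM natr_sum.
move: Hx; rewrite ler_norml => /andP[_]; move: (\sum_(_ < _) _) => T.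
move: (Num.trunc x)%:R (delta_z R d k)%:R (ler0n R (delta_z R d k)) => n D D0 HT xn HD.
set y := x ^+ d in HT kE *; have y0 : 0 <= y by rewrite exprn_ge0.
have dk : d%:R * k%:R = A * x ^+ d.+1 - k%:R.
  by rewrite -kE -natr1; ring.
have kA : k%:R = A / d.+1%:R * x ^+ d.+1.
  by rewrite mulrAC -kE mulrC mulKf.
have HDn : D * n <= (A + e / 2) * x ^+ d.+1.
  apply: le_trans HD _; rewrite dk kA.
  by move: (A / d.+1%:R) (x ^+ d.+1) HT => p z; lra.
have x1 : 0 < x - 1 by lra.
rewrite -(ler_pM2r x1); apply: (@le_trans _ _ (D * n)).
  by rewrite ler_wpM2l//; lra.
apply: le_trans HDn _; rewrite exprS -/y.
have := ler_wpM2r y0 ex; lra.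
Qed.

(** The radius is shrunk to [l x] with [l = 1 - h], so that the half ball respects the bound [d k]
    in spite of the error terms. *)
Lemma delta_lower (e : R) : 0 < e -> exists X, forall x (k : nat), X <= x ->
  d.+1%:R * k%:R = A * x ^+ d.+1 -> (A - e) * x ^+ d <= (delta_z R d k)%:R.
Proof.
move=> e0; have dR : (0 : R) < d%:R by rewrite ltr0n ltnW.
have Ad0 : 0 < A * d%:R by rewrite mulr_gt0.
(* As [l ^+ d >= 1 - d h], shrinking costs at most [e / 2] in the coefficient of the count; [2^-1]
   keeps [l] positive. *)
pose h := Num.min 2^-1 (e / 2 / (A * d%:R)).
have h0 : 0 < h by rewrite lt_min invr_gt0 ltr0n !divr_gt0.
have h2 : h <= 2^-1 by rewrite ge_min lexx.
have hA : A * d%:R * h <= e / 2.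
  by rewrite mulrC -ler_pdivlMr// ge_min lexx orbT.
pose l := 1 - h; have l0 : 0 < l by rewrite /l; move: h2; lra.
pose q := A / d.+1%:R * d%:R.
have q0 : 0 < q by rewrite mulr_gt0// divr_gt0.
(* The sum of norms is at most [(q + 2 e1) (l x)^(d+1)], with one error from the count and one from
   the sum over radii; [e1 <= q h / 2] gives [(q + 2 e1) (1 - h) <= q]. *)
pose e1 := Num.min (e / 2) (q * h / 2).
have e10 : 0 < e1 by rewrite lt_min !divr_gt0// mulr_gt0.
have e1e : e1 <= e / 2 by rewrite ge_min lexx.
have e1q : e1 <= q * h / 2 by rewrite ge_min lexx orbT.
have [X HX] := half_prim_asymp e10.
have [Y HY] := asymp_half_prim_sum e10.
exists (`|X| / l + `|Y| / l) => x k XYx kE.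
have X0 : 0 <= `|X| / l by rewrite divr_ge0// ltW.
have Y0 : 0 <= `|Y| / l by rewrite divr_ge0// ltW.
have x0 : 0 <= x by lra.
have lx0 : 0 <= l * x by rewrite mulr_ge0// ltW.
have Xl : X <= l * x.
  by apply: le_trans (ler_norm _) _; rewrite mulrC -ler_pdivrMr//; lra.
have Yl : Y <= l * x.
  by apply: le_trans (ler_norm _) _; rewrite mulrC -ler_pdivrMr//; lra.
have := HX _ Xl; have := HY _ Yl; have /andP[nx _] := truncn_itv lx0.
have := sum_half_prim_norm d (Num.trunc (l * x)).
set n := Num.trunc (l * x) in nx *.
move=> /(congr1 (fun m => m%:R : R)); rewrite natrD natrM.
rewrite [X in _ + X]natr_sum !ler_norml => SE /andP[T1 _] /andP[N1 N2].
have lxd : 0 <= (l * x) ^+ d by rewrite exprn_ge0.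
have lx1 : 0 <= (l * x) ^+ d.+1 by rewrite exprn_ge0.
have y0 : 0 <= x ^+ d by rewrite exprn_ge0.
have y1 : 0 <= x ^+ d.+1 by rewrite exprn_ge0.
have ld : 1 - d%:R * h <= l ^+ d.
  have := @bernoulli R d.-1 1 (- h) ler01; rewrite !expr1n prednK; last exact: ltnW.
  by rewrite mulr1 mulrN; apply; exact: ltW.
have ld1 : l ^+ d.+1 <= 1 - h.
  have l1 : l <= 1 by rewrite /l; lra.
  by rewrite exprS -[leRHS]mulr1 ler_wpM2l ?(ltW l0)// exprn_ile1// ltW.
have [_ ub] := delta_zP k.
have dk : d%:R * k%:R = q * x ^+ d.+1.
  have kA : k%:R = A / d.+1%:R * x ^+ d.+1.
    by rewrite mulrAC -kE mulrC mulKf.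
  by rewrite kA /q; ring.
have /ub : zonotope_diameters R d k (size (half_prim_ball d n)).
  apply: diameters_lower; last exact: ltnW.
  rewrite -(ler_nat R) natrM dk.
  set S := (\sum_(v <- _) _)%:R in SE *; set T := \sum_(_ < _) _ in SE T1.
  set N := (size _)%:R in SE N1 N2.
  have N0 : 0 <= N by rewrite /N.
  have SN : S <= (q + 2 * e1) * (l * x) ^+ d.+1.
    have nN : n%:R * N <= l * x * N by rewrite ler_wpM2r.
    have NN : l * x * N <= l * x * ((A + e1) * (l * x) ^+ d) by rewrite ler_wpM2l//; lra.
    have qA : q = A - A / d.+1%:R by rewrite /q -[d.+1%:R]natr1; field; rewrite natr1.
    have zE : l * x * ((A + e1) * (l * x) ^+ d) = (A + e1) * (l * x) ^+ d.+1.
      by rewrite exprS; ring.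
    rewrite qA; rewrite {}zE in NN; move: T1 NN nN SE; clear.
    by move: (A / d.+1%:R) ((l * x) ^+ d.+1) => p z; lra.
  apply: le_trans SN _; rewrite exprMn mulrA ler_wpM2r//.
  apply: (@le_trans _ _ ((q + 2 * e1) * (1 - h))).
    by apply: ler_wpM2l => //; exact: addr_ge0 (ltW q0) (mulr_ge0 (ler0n R 2) (ltW e10)).
  have := mulr_ge0 (ltW e10) (ltW h0); lra.
rewrite leEnat -(ler_nat R); apply: le_trans.
apply: (@le_trans _ _ ((A - e1) * (l * x) ^+ d)); last by lra.
rewrite exprMn mulrA ler_wpM2r//.
have l1 : l ^+ d <= 1.
  by rewrite exprn_ile1 ?(ltW l0)// /l; lra.
have := ler_wpM2l (ltW e10) l1; have := ler_wpM2l (ltW A_gt0) ld; lra.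
Qed.

End DeltaAsymptotics.

(** * The limit *)

Theorem theorem1p1 (R : realType) (d : nat) (hd : (2 <= d)%N) :
  ((delta_z R d k)%:R / (k%:R `^ (d%:R / d.+1%:R)) : R) @[k --> \oo]
    --> c_zonotope R d.
Proof.
pose A := half_density R d; have A0 : 0 < A := half_density_gt0 R hd.
have d1 : (0 : R) < d.+1%:R by [].
pose root (z : R) := z `^ d.+1%:R^-1.
have rootE z : 0 <= z -> root z ^+ d.+1 = z.
  move=> z0; rewrite -powR_mulrn ?powR_ge0// -powRrM mulVf ?powRr1//.
have root0 z : 0 <= root z by rewrite powR_ge0.
have rhoA : 0 < d.+1%:R / A by rewrite divr_gt0.
(* With this factor [x = rho k^(1/(d+1))] solves [d.+1 k = A x^(d+1)], and
   [A x^d = A rho^d k^(d/(d+1))]. *)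
pose rho := root (d.+1%:R / A).
have rho0 : 0 < rho by rewrite powR_gt0.
have cE : c_zonotope R d = A * rho ^+ d.
  have c0 : 0 <= 2 ^+ d * d.+1%:R ^+ d / (2 * d`!%:R * zeta R d).
    by rewrite divr_ge0 ?mulr_ge0 ?exprn_ge0// (le_trans _ (zeta_ge1 R hd)).
  apply/eqP; rewrite -(@eqrXn2 _ d.+1)//; [|exact: root0|by rewrite mulr_ge0 ?exprn_ge0// ltW].
  rewrite /c_zonotope -/(root _) rootE// exprMn -exprM mulnC exprM rootE; last exact: ltW.
  have powE (a : R) : a != 0 -> a ^+ d.+1 * (d.+1%:R / a) ^+ d = a * d.+1%:R ^+ d.
    by move=> a0; rewrite expr_div_n exprS mulrA mulrAC mulfK// expf_neq0.
  rewrite (powE A (lt0r_neq0 A0)).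
  rewrite /A /half_density; apply/eqP; field.
  have z0 : zeta R d != 0 by rewrite lt0r_neq0// (lt_le_trans _ (zeta_ge1 R hd)).
  by rewrite z0 pnatr_eq0 -lt0n fact_gt0.
apply/cvgrPdist_le => e e0.
have rd0 : 0 < rho ^+ d by rewrite exprn_gt0.
have e1 : 0 < e / rho ^+ d by rewrite divr_gt0.
have [X HX] := delta_upper hd e1; have [Y HY] := delta_lower hd e1.
(* Once [root k >= b], the scale [rho * root k] exceeds both thresholds [X] and [Y]. *)
pose b := (`|X| + `|Y| + 1) / rho.
have b0 : 0 < b by rewrite divr_gt0// ltr_wpDl// addr_ge0.
exists (Num.trunc (b ^+ d.+1)).+1 => // k /= Nk.
have bk : b <= root k%:R.
  rewrite leNgt; apply/negP => kb.
  have : root k%:R ^+ d.+1 < b ^+ d.+1 by rewrite ltr_pXn2r ?nnegrE// ltW.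
  rewrite rootE// ltNge => /negP; apply; apply: ltW; apply: lt_le_trans (truncnS_gt _) _.
  by rewrite ler_nat.
have k0 : 0 < root k%:R by exact: lt_le_trans bk.
have kE : d.+1%:R * k%:R = A * (rho * root k%:R) ^+ d.+1.
  by rewrite exprMn !rootE// ?(ltW rhoA)// mulrA mulrCA divff ?mulr1// lt0r_neq0.
have bx : `|X| + `|Y| + 1 <= rho * root k%:R.
  by rewrite mulrC -ler_pdivrMr.
have Xx : X <= rho * root k%:R.
  by apply: le_trans bx; rewrite -addrA (le_trans (ler_norm X))// lerDl addr_ge0.
have Yx : Y <= rho * root k%:R.
  by apply: le_trans bx; rewrite addrAC (le_trans (ler_norm Y))// lerDr addr_ge0.
have := HX _ _ Xx kE; have := HY _ _ Yx kE; rewrite -/A cE exprMn.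
rewrite [d%:R / _]mulrC powRrM powR_mulrn// -/(root _).
have kd0 : 0 < root k%:R ^+ d by rewrite exprn_gt0.
move: (delta_z R d k)%:R => D; rewrite !mulrA -(ler_pdivlMr _ _ kd0) => D1.
rewrite -(ler_pdivrMr _ _ kd0) => D2; move: D1 D2.
rewrite mulrBl mulrDl divfK ?lt0r_neq0// => D1 D2.
by rewrite ler_norml; apply/andP; split; lra.
Qed.
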